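(* There is a constant $A>0$ with the following property. Let $\Lambda$ be a locally compact Polish space and $\lambda$ a positive Radon measure on $\Lambda$. Let $K:\Lambda \times \Lambda \to \mathbb{C}$ be a measurable function such that the associated integral operator on $\mathbb{L}_2(\lambda)$ is a self-adjoint projection of finite rank (i.e. $K^2=K$ and $K^*=K$). Then for any bounded $f:\Lambda\to\mathbb{R}$ and any $\varepsilon>0$, the linear statistic $X_f$ of the determinantal point process with kernel $K$ satisfies $$P(\left|X_f-\mathbb{E} X_f \right|\geq \varepsilon) \leq \begin{cases} 2\exp \left(- \frac{\varepsilon^2 }{4 A \operatorname{Var} X_f}\right), &\text{if } \varepsilon <\frac{2 A \operatorname{Var} X_f}{3 \|f\|_\infty}, \\[4pt] 2\exp \left(- \frac{\varepsilon }{6 \|f\|_\infty} \right), &\text{if } \varepsilon \geq \frac{2A \operatorname{Var} X_f}{3 \|f\|_\infty }, \end{cases}$$ where the constant $A$ does not depend on $f$, $K$ or $\varepsilon$.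
   Context: The kernel satisfies $K(y,x)=\overline{K(x,y)}$ and $\int K(x,y)K(y,z)\,d\lambda(y)=K(x,z)$ for $x,z\in\Lambda$, and its integral operator has finite rank $N$. Such a $K$ defines a determinantal point process on $\Lambda$ with reference measure $\lambda$: a random point configuration $\{x_j\}$ in $\Lambda$ such that for every bounded measurable $\phi$, $$\mathbb{E}\Big[\prod_j(1+\phi(x_j))\Big]=\sum_{k=0}^N\frac{1}{k!}\int\cdots\int\phi(x_1)\cdots\phi(x_k)\det\big(K(x_i,x_j)\big)_{i,j=1}^k\,d\lambda(x_1)\cdots d\lambda(x_k).$$ For a bounded measurable $f$, the linear statistic is $X_f=\sum_j f(x_j)$, and $\|f\|_\infty$ is the supremum norm (take $f\neq0$; for $f=0$ the statement is trivial). *)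

(* Defs.v *)
From HB Require Import structures.
From mathcomp Require Import all_boot all_order all_algebra.
From mathcomp Require Import complex.
From mathcomp Require Import all_classical all_reals all_analysis.

Set Implicit Arguments.
Unset Strict Implicit.
Unset Printing Implicit Defensive.

Import Order.TTheory GRing.Theory Num.Theory.
Import numFieldNormedType.Exports.

Local Open Scope classical_set_scope.
Local Open Scope ring_scope.

(* [complex.Re]/[complex.Im] are the [R]-valued real and imaginary parts of
   [z : R[i]]; the notations ['Re]/['Im] of ssrnum would be [R[i]]-valued. *)
Notation cRe := complex.Re.
Notation cIm := complex.Im.

Notation borel T := (g_sigma_algebraType (@open T)).

Definition separable (T : topologicalType) : Prop :=
  exists2 D : set T, countable D & dense D.

Definition completely_metrizable (R : realType) (T : topologicalType) : Prop :=
  exists d : T -> T -> R,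
    [/\ forall x y, d x y = 0 <-> x = y,
        forall x y, d x y = d y x,
        forall x y z, d x z <= d x y + d y z,
        forall (x : T) (A : set T), nbhs x A <->
          exists2 e : R, 0 < e & [set y | d x y < e] `<=` A &
        forall u : nat -> T,
          (forall e : R, 0 < e -> exists m0 : nat, forall m n : nat,
             (m0 <= m)%N -> (m0 <= n)%N -> d (u m) (u n) < e) ->
          exists l : T, u @ \oo --> l].

Definition polish (R : realType) (T : topologicalType) : Prop :=
  separable T /\ completely_metrizable R T.

Definition radon_measure (R : realType) (T : ptopologicalType)
    (lam : {measure set (borel T) -> \bar R}) : Prop :=
  [/\ forall C : set T, compact C -> (lam C < +oo)%E,
      forall B : set (borel T), measurable B ->
        lam B = ereal_inf [set lam U | U in [set U : set T | open U /\ B `<=` U]]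
    & forall U : set T, open U ->
        lam U = ereal_sup [set lam C | C in [set C : set T | compact C /\ C `<=` U]]].

Section ComplexL2.
Context {d : measure_display} {T : measurableType d} {R : realType}.
Variable lam : {measure set T -> \bar R}.
Implicit Types (g h : T -> R[i]) (K : T -> T -> R[i]).

Definition cmeasurable g : Prop :=
  measurable_fun setT (fun x => cRe (g x)) /\
  measurable_fun setT (fun x => cIm (g x)).

Definition cintegrable g : Prop :=
  lam.-integrable setT (fun x => (cRe (g x))%:E) /\
  lam.-integrable setT (fun x => (cIm (g x))%:E).

Definition cintegral g : R[i] :=
  Complex (\int[lam]_x cRe (g x)) (\int[lam]_x cIm (g x)).

Definition in_L2 g : Prop :=
  cmeasurable g /\
  (\int[lam]_x (cRe (g x) ^+ 2 + cIm (g x) ^+ 2)%:E < +oo)%E.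

Definition cinner g h : R[i] := cintegral (fun x => g x * conjc (h x)).

Definition integral_operator K g : T -> R[i] :=
  fun x => cintegral (fun y => K x y * g y).

(* The range of the operator on L2, modulo a.e. equality, has dimension N:
   the images of u_0, ..., u_(N-1) form a basis of it. *)
Definition operator_rank K (N : nat) : Prop :=
  exists u : 'I_N -> T -> R[i],
    [/\ forall i, in_L2 (u i),
        forall c : 'I_N -> R[i],
          {ae lam, forall x,
            \sum_(i < N) c i * integral_operator K (u i) x = 0} ->
          forall i, c i = 0 &
        forall g, in_L2 g -> exists c : 'I_N -> R[i],
          {ae lam, forall x, integral_operator K g x =
            \sum_(i < N) c i * integral_operator K (u i) x}].

Definition self_adjoint_projection K : Prop :=
  [/\ forall g, in_L2 g ->
        {ae lam, forall x, cintegrable (fun y => K x y * g y)} /\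
        in_L2 (integral_operator K g),
      forall g h, in_L2 g -> in_L2 h ->
        cinner (integral_operator K g) h = cinner g (integral_operator K h) &
      forall g, in_L2 g ->
        {ae lam, forall x,
          integral_operator K (integral_operator K g) x =
          integral_operator K g x}].

(* The operator only determines K up to null sets of pairs, whereas the
   determinants below see K on the diagonal; hence the pointwise identities. *)
Definition hermitian_kernel K : Prop := forall x y, K y x = conjc (K x y).

Definition reproducing_kernel K : Prop := forall x z,
  cintegrable (fun y => K x y * K y z) /\
  cintegral (fun y => K x y * K y z) = K x z.

Definition projection_kernel K (N : nat) : Prop :=
  [/\ measurable_fun setT (fun p : T * T => cRe (K p.1 p.2)),
      measurable_fun setT (fun p : T * T => cIm (K p.1 p.2)),
      hermitian_kernel K /\ reproducing_kernel K,
      self_adjoint_projection K & operator_rank K N].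

Fixpoint iterated_integral (k : nat) : (k.-tuple T -> R) -> R :=
  match k with
  | 0 => fun F => F [tuple]
  | k'.+1 => fun F =>
      \int[lam]_x iterated_integral (fun t : k'.-tuple T => F [tuple of x :: t])
  end.

End ComplexL2.

Section PointProcess.
Context {d d' : measure_display} {T : measurableType d} {R : realType}.
Context {Omega : measurableType d'}.
Implicit Types (X : Omega -> seq T) (f phi : T -> R).

(* A configuration is a finite multiset of points, listed in an arbitrary
   order: only symmetric functions of the list are ever considered. *)
Definition random_configuration X : Prop :=
  forall B : set T, measurable B ->
    measurable_fun setT (fun w => count (fun x => x \in B) (X w)).

Definition linear_statistic X f : Omega -> R :=
  fun w => \sum_(x <- X w) f x.

(* For a hermitian K the determinant is real, so that taking its real part
   only changes its type. *)
Definition determinantal_process (P : probability Omega R) X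
    (lam : {measure set T -> \bar R}) (K : T -> T -> R[i]) (N : nat) : Prop :=
  random_configuration X /\
  forall phi, measurable_fun setT phi -> bounded_fun phi ->
    ('E_P[fun w => (\prod_(x <- X w) (1 + phi x))%R] =
     (\sum_(0 <= k < N.+1) (k`!%:R)^-1 *
        iterated_integral lam (fun t : k.-tuple T =>
          (\prod_(i < k) phi (tnth t i)) *
          cRe (\det (\matrix_(i < k, j < k) K (tnth t i) (tnth t j)))))%:E)%E.

End PointProcess.

Definition sup_norm (R : realType) (T : Type) (f : T -> R) : R :=
  sup (range (fun x => `|f x|)).

(* Main.v *)
(* In an orthonormal basis psi of the range of K that diagonalises the Hermitian
   form of a bounded h, the Fredholm sum for h collapses to prod_j (1 + mu_j) with
   mu_j = int h |psi_j|^2.  Take psi adapted to f, and let xi_i be independent with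
   densities |psi_i|^2: expanding E prod (1 + r f) to second order in r shows that
   sum_i f(xi_i) has the same mean and the same variance as X_f.  For h = e^(tf) - 1,
   passing from the basis adapted to h to psi is Hadamard's inequality, so
   E e^(t X_f) <= prod_i int e^(tf) |psi_i|^2: the Laplace transform of X_f is at most
   that of the independent sum, to which the classical Bernstein argument applies
   (e^u <= 1 + u + 2 u^2 for |u| <= 2/3), giving A = 2. *)
Require Import Defs.
From HB Require Import structures.
From mathcomp Require Import all_boot all_order all_algebra.
From mathcomp Require Import fingroup perm finmap.
From mathcomp Require Import complex.
From mathcomp Require Import ring lra.
From mathcomp Require Import all_classical all_reals all_analysis.
From mathcomp Require Import measurable_realfun.
Set Implicit Arguments.
Unset Strict Implicit.
Unset Printing Implicit Defensive.
Import Order.TTheory GRing.Theory Num.Theory.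
Import numFieldNormedType.Exports.
Local Open Scope classical_set_scope.
Local Open Scope ring_scope.

(** The process is given only through expectations of products. Moments are therefore read off by
    comparing coefficients: for small [r] both sides of the product formula for [r * f] agree with
    quadratic polynomials up to an explicit cubic error. The random error is dominated by a multiple
    of prod (1 + 2|f(x_j)|), which is again a product covered by the formula and hence integrable.
    Two bases occur because compressing multiplication operators to the range of K is not
    multiplicative: a basis that diagonalises the form of f need not diagonalise that of e^(tf) - 1.
    Hence the Laplace transforms are only compared, in the direction that tail bounds require.
    Determinants see K on the diagonal, so the basis must represent K at every pair of points, while
    rank and projection are known modulo null sets; applying the operator once more removes the
    exceptional sets. With |f| <= M each f(xi_i) differs from its mean by at most 2M, so |t| M <=
    1/3 keeps exponents in the range |u| <= 2/3. *)

(** * Complex integrals and L2 *)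

Section ComplexIntegral.
Context {d : measure_display} {T : measurableType d} {R : realType}.
Variable lam : {measure set T -> \bar R}.
Implicit Types (g h : T -> R[i]) (p q : T -> R).

Local Notation intg p := (lam.-integrable setT (EFin \o p)).

Lemma cReD (a b : R[i]) : cRe (a + b) = cRe a + cRe b.
Proof. by case: a; case: b. Qed.

Lemma cImD (a b : R[i]) : cIm (a + b) = cIm a + cIm b.
Proof. by case: a; case: b. Qed.

Lemma cReM (a b : R[i]) : cRe (a * b) = cRe a * cRe b - cIm a * cIm b.
Proof. by case: a; case: b. Qed.

Lemma cImM (a b : R[i]) : cIm (a * b) = cRe a * cIm b + cIm a * cRe b.
Proof. by case: a => a1 a2; case: b. Qed.

Lemma cReJ (a : R[i]) : cRe (conjc a) = cRe a.
Proof. by case: a. Qed.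

Lemma cImJ (a : R[i]) : cIm (conjc a) = - cIm a.
Proof. by case: a. Qed.

Lemma complex_ext (a b : R[i]) : cRe a = cRe b -> cIm a = cIm b -> a = b.
Proof. by case: a => a1 a2; case: b => b1 b2 /= -> ->. Qed.

Definition cE := (cReD, cImD, cReM, cImM, cReJ, cImJ).

Lemma integrable_add p q : intg p -> intg q -> intg (fun x => p x + q x).
Proof. by move=> ip iq; exact: (integrableD measurableT ip iq). Qed.

Lemma integrable_scale (r : R) p : intg p -> intg (fun x => r * p x).
Proof. by move=> ip; exact: (integrableZl measurableT r ip). Qed.

Lemma integrable_sub p q : intg p -> intg q -> intg (fun x => p x - q x).
Proof. by move=> ip iq; exact: (integrableB measurableT ip iq). Qed.

Lemma integrable_dominated p q : measurable_fun setT p -> intg q ->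
  (forall x, `|p x| <= q x) -> intg p.
Proof.
move=> mp iq pq; apply: (le_integrable measurableT _ _ iq).
  exact/measurable_EFinP.
by move=> x _ /=; rewrite lee_fin (le_trans (pq x))// ler_norm.
Qed.

Lemma cintegrableD g h : cintegrable lam g -> cintegrable lam h ->
  cintegrable lam (fun x => g x + h x).
Proof.
move=> [g1 g2] [h1 h2]; split.
- apply: eq_integrable (integrable_add g1 h1) => // x _ /=; by rewrite cE.
- apply: eq_integrable (integrable_add g2 h2) => // x _ /=; by rewrite cE.
Qed.

Lemma cintegralD g h : cintegrable lam g -> cintegrable lam h ->
  cintegral lam (fun x => g x + h x) = cintegral lam g + cintegral lam h.
Proof.
move=> [g1 g2] [h1 h2]; apply: complex_ext; rewrite /cintegral/=.
- by rewrite -RintegralD//; apply: eq_Rintegral => x _; rewrite cE.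
- by rewrite -RintegralD//; apply: eq_Rintegral => x _; rewrite cE.
Qed.

Lemma cintegrableZ c g : cintegrable lam g -> cintegrable lam (fun x => c * g x).
Proof.
move=> [g1 g2]; split.
- apply: eq_integrable
    (integrable_sub (integrable_scale (cRe c) g1) (integrable_scale (cIm c) g2)) => // x _ /=.
  by rewrite cE.
- apply: eq_integrable
    (integrable_add (integrable_scale (cRe c) g2) (integrable_scale (cIm c) g1)) => // x _ /=.
  by rewrite cE.
Qed.

Lemma cintegralZ c g : cintegrable lam g ->
  cintegral lam (fun x => c * g x) = c * cintegral lam g.
Proof.
move=> [g1 g2]; apply: complex_ext; rewrite ?cE /cintegral/=.
- rewrite -!RintegralZl// -RintegralB//; try exact: integrable_scale.
  by apply: eq_Rintegral => x _; rewrite cE.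
- rewrite -!RintegralZl// -RintegralD//; try exact: integrable_scale.
  by apply: eq_Rintegral => x _; rewrite cE.
Qed.

Lemma cintegral0 : cintegral lam (fun=> 0) = 0.
Proof. by rewrite /cintegral /= !Rintegral_cst//= !mul0r. Qed.

Lemma cintegrable0 : cintegrable lam (fun=> 0).
Proof. by split => /=; exact: integrable0. Qed.

Lemma cintegrable_sum I (s : seq I) (F : I -> T -> R[i]) :
  (forall i, cintegrable lam (F i)) ->
  cintegrable lam (fun x => \sum_(i <- s) F i x).
Proof.
move=> iF; elim: s => [|i s IH].
  under eq_fun do rewrite big_nil; exact: cintegrable0.
under eq_fun do rewrite big_cons; exact: cintegrableD.
Qed.

Lemma cintegral_sum I (s : seq I) (F : I -> T -> R[i]) :
  (forall i, cintegrable lam (F i)) ->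
  cintegral lam (fun x => \sum_(i <- s) F i x) = \sum_(i <- s) cintegral lam (F i).
Proof.
move=> iF; elim: s => [|i s IH].
  under eq_fun do rewrite big_nil; by rewrite big_nil cintegral0.
under eq_fun do rewrite big_cons.
by rewrite cintegralD// ?IH ?big_cons//; exact: cintegrable_sum.
Qed.

Lemma cintegral_conj g : cintegrable lam g ->
  cintegral lam (fun x => conjc (g x)) = conjc (cintegral lam g).
Proof.
move=> [g1 g2]; apply: complex_ext; rewrite ?cE /cintegral/=.
- by apply: eq_Rintegral => x _; rewrite cE.
- rewrite -mulN1r -RintegralZl//.
  by apply: eq_Rintegral => x _; rewrite cE mulN1r.
Qed.

Lemma cmeasurableD g h : cmeasurable g -> cmeasurable h ->
  cmeasurable (fun x => g x + h x).
Proof.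
move=> [g1 g2] [h1 h2]; split.
- under eq_fun do rewrite cE; exact: measurable_funD.
- under eq_fun do rewrite cE; exact: measurable_funD.
Qed.

Lemma cmeasurableM g h : cmeasurable g -> cmeasurable h ->
  cmeasurable (fun x => g x * h x).
Proof.
move=> [g1 g2] [h1 h2]; split.
- under eq_fun do rewrite cE; by apply: measurable_funB; exact: measurable_funM.
- under eq_fun do rewrite cE; by apply: measurable_funD; exact: measurable_funM.
Qed.

Lemma cmeasurable_cst c : cmeasurable (fun _ : T => c : R[i]).
Proof. by split; exact: measurable_cst. Qed.

Lemma cmeasurable_conj g : cmeasurable g -> cmeasurable (fun x => conjc (g x)).
Proof.
move=> [g1 g2]; split.
- by under eq_fun do rewrite cE.
- by under eq_fun do rewrite cE; exact: measurableT_comp.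
Qed.

Lemma cintegral_ae g h : cmeasurable g -> cmeasurable h ->
  {ae lam, forall x, g x = h x} -> cintegral lam g = cintegral lam h.
Proof.
move=> [g1 g2] [h1 h2] gh.
congr Complex; congr fine; apply: ae_eq_integral => //.
- exact/measurable_EFinP.
- exact/measurable_EFinP.
- by apply: filterS gh => x -> .
- exact/measurable_EFinP.
- exact/measurable_EFinP.
- by apply: filterS gh => x -> .
Qed.

Definition sqmod (z : R[i]) : R := cRe z ^+ 2 + cIm z ^+ 2.

Lemma sqmod_ge0 z : 0 <= sqmod z.
Proof. by rewrite addr_ge0 ?sqr_ge0. Qed.

Lemma mulc_conj (z : R[i]) : z * conjc z = (real_complex R (sqmod z)).
Proof.
by apply: complex_ext; rewrite !cE /sqmod /=; ring.
Qed.

Lemma measurable_sqmod g : cmeasurable g -> measurable_fun setT (fun x => sqmod (g x)).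
Proof.
by move=> [g1 g2]; apply: measurable_funD; apply: measurable_funX.
Qed.

Lemma in_L2P g : in_L2 lam g <->
  cmeasurable g /\ intg (fun x => sqmod (g x)).
Proof.
split=> -[mg ig]; split=> //.
- apply/integrableP; split; first exact/measurable_EFinP/measurable_sqmod.
  by under eq_integral do rewrite /= ger0_norm ?sqmod_ge0//.
- case/integrableP: ig => _.
  by under eq_integral do rewrite /= ger0_norm ?sqmod_ge0//.
Qed.

(** An AM-GM bound on both real components: it dominates g * conj(h) by the integrable function
    |g|^2 + |h|^2. *)
Lemma le_sqmodM (a b : R[i]) :
  (`|cRe (a * conjc b)| <= sqmod a + sqmod b) /\
  (`|cIm (a * conjc b)| <= sqmod a + sqmod b).
Proof.
case: a => a1 a2; case: b => b1 b2; rewrite !cE /= /sqmod/=.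
have := (sqr_ge0 (a1 - b1), sqr_ge0 (a1 + b1), sqr_ge0 (a2 - b2), sqr_ge0 (a2 + b2)).
have := (sqr_ge0 (a1 - b2), sqr_ge0 (a1 + b2), sqr_ge0 (a2 - b1), sqr_ge0 (a2 + b1)).
move=> [[[h1 h2] h3] h4] [[[h5 h6] h7] h8].
by split; rewrite ler_norml; apply/andP; split; nra.
Qed.

Lemma cintegrable_L2 g h : in_L2 lam g -> in_L2 lam h ->
  cintegrable lam (fun x => g x * conjc (h x)).
Proof.
move=> /in_L2P[mg ig] /in_L2P[mh ih].
have [m1 m2] := cmeasurableM mg (cmeasurable_conj mh).
split; apply: (integrable_dominated _ (integrable_add ig ih)) => // x.
- by have [] := le_sqmodM (g x) (h x).
- by have [] := le_sqmodM (g x) (h x).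
Qed.

Lemma sqmodD_le (a b : R[i]) : sqmod (a + b) <= 2 * sqmod a + 2 * sqmod b.
Proof.
case: a => a1 a2; case: b => b1 b2; rewrite /sqmod !cE /=.
by have := sqr_ge0 (a1 - b1); have := sqr_ge0 (a2 - b2); nra.
Qed.

Lemma sqmodM (a b : R[i]) : sqmod (a * b) = sqmod a * sqmod b.
Proof. case: a => a1 a2; case: b => b1 b2; rewrite /sqmod !cE /=; ring. Qed.

Lemma sqmodJ (a : R[i]) : sqmod (conjc a) = sqmod a.
Proof. by rewrite /sqmod !cE sqrrN. Qed.

Lemma in_L2D g h : in_L2 lam g -> in_L2 lam h -> in_L2 lam (fun x => g x + h x).
Proof.
move=> /in_L2P[mg ig] /in_L2P[mh ih]; apply/in_L2P.
have m := cmeasurableD mg mh; split=> //.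
apply: (integrable_dominated (measurable_sqmod m)
   (integrable_add (integrable_scale 2 ig) (integrable_scale 2 ih))) => x.
by rewrite ger0_norm ?sqmod_ge0// sqmodD_le.
Qed.

Lemma in_L2Z c g : in_L2 lam g -> in_L2 lam (fun x => c * g x).
Proof.
move=> /in_L2P[mg ig]; apply/in_L2P; split.
  exact: cmeasurableM (cmeasurable_cst c) mg.
by apply: eq_integrable (integrable_scale (sqmod c) ig) => // x _ /=; rewrite sqmodM.
Qed.

Lemma in_L2_sum I (s : seq I) (F : I -> T -> R[i]) :
  (forall i, in_L2 lam (F i)) -> in_L2 lam (fun x => \sum_(i <- s) F i x).
Proof.
move=> iF; elim: s => [|i s IH].
  under eq_fun do rewrite big_nil.
  apply/in_L2P; split; first exact: cmeasurable_cst.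
  by under eq_fun do rewrite /sqmod/= expr0n addr0; exact: integrable0.
under eq_fun do rewrite big_cons; exact: in_L2D.
Qed.

Lemma in_L2_conj g : in_L2 lam g -> in_L2 lam (fun x => conjc (g x)).
Proof.
move=> /in_L2P[mg ig]; apply/in_L2P; split; first exact: cmeasurable_conj.
by apply: eq_integrable ig => // x _ /=; rewrite sqmodJ.
Qed.

Lemma cinner_norm0 g : in_L2 lam g -> cinner lam g g = 0 ->
  {ae lam, forall x, g x = 0}.
Proof.
move=> Lg /(congr1 (@cRe R)).
have [mg ig] := (in_L2P g).1 Lg.
rewrite /cinner /cintegral /=.
under eq_Rintegral do rewrite mulc_conj/=.
move=> i0.
have {}i0 : (\int[lam]_x `|(sqmod (g x))%:E| = 0)%E.
  under eq_integral do rewrite /= ger0_norm ?sqmod_ge0//.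
  rewrite -[LHS]fineK; first by congr EFin.
  exact: integrable_fin_num ig.
have /= [] := ae_eq_integral_abs lam measurableT
  ((measurable_EFinP setT _).2 (measurable_sqmod mg)).
move=> /(_ i0) + _; apply: filterS => x /(_ I) [] /eqP.
by rewrite paddr_eq0 ?sqr_ge0// !sqrf_eq0 => /andP[/eqP r0 /eqP m0]; apply: complex_ext.
Qed.

End ComplexIntegral.

(** * Orthonormal bases of the range *)

Section Frames.
Context {d : measure_display} {T : measurableType d} {R : realType}.
Variable lam : {measure set T -> \bar R}.
Variable N : nat.
Implicit Types (g : T -> R[i]) (h : T -> R) (psi : 'I_N -> T -> R[i]).
Implicit Types (U G : 'M[R[i]]_N).

Local Notation C := (real_complex R).

Lemma cintegrable_bounded h g : measurable_fun setT h -> bounded_fun h ->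
  cintegrable lam g -> cintegrable lam (fun x => C (h x) * g x).
Proof.
move=> mh [M [_ hM]] [g1 g2].
have {}hM x : `|h x| <= `|M| + 1 by apply: hM => //; rewrite ltr_pwDr// ler_norm.
have mR p : lam.-integrable setT (EFin \o p) -> lam.-integrable setT (EFin \o (fun x => h x * p x)).
  move=> ip.
  have mp : measurable_fun setT p by apply/measurable_EFinP; exact: (measurable_int _ ip).
  apply: (integrable_dominated (measurable_funM mh mp)
    (integrable_scale (`|M| + 1) (integrable_norm ip))) => x.
  by rewrite normrM ler_wpM2r.
split.
- by apply: eq_integrable (mR _ g1) => // x _ /=; rewrite cE /= mul0r subr0.
- by apply: eq_integrable (mR _ g2) => // x _ /=; rewrite cE /= mul0r addr0.
Qed.

(** The matrix of the Hermitian form of [h]. For [h = 1] it is the Gram matrix of [psi], so a single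
    change-of-basis formula serves both orthogonalisation and diagonalisation. *)
Definition wgram h psi : 'M[R[i]]_N :=
  \matrix_(i, j) cintegral lam (fun x => C (h x) * (psi i x * conjc (psi j x))).

Definition change U psi : 'I_N -> T -> R[i] :=
  fun i x => \sum_j U i j * psi j x.

Definition adj U : 'M[R[i]]_N := \matrix_(i, j) conjc (U j i).

Lemma wgram_change h psi U : measurable_fun setT h -> bounded_fun h ->
  (forall i, in_L2 lam (psi i)) ->
  wgram h (change U psi) = U *m wgram h psi *m adj U.
Proof.
move=> mh bh Lpsi; apply/matrixP => i j; rewrite !mxE.
have iab a b : cintegrable lam (fun x => C (h x) * (psi a x * conjc (psi b x))).
  by apply: cintegrable_bounded => //; exact: cintegrable_L2.
transitivity (cintegral lam (fun x => \sum_b \sum_a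
    (U i a * conjc (U j b)) * (C (h x) * (psi a x * conjc (psi b x))))).
  congr cintegral; apply/funext => x.
  rewrite /change raddf_sum/= mulr_sumr mulr_sumr; apply: eq_bigr => b _.
  rewrite mulr_suml mulr_sumr; apply: eq_bigr => a _.
  by rewrite rmorphM/=; ring.
rewrite cintegral_sum; last first.
  by move=> b; apply: cintegrable_sum => a; exact: cintegrableZ.
apply: eq_bigr => b _; rewrite cintegral_sum; last first.
  by move=> a; exact: cintegrableZ.
rewrite !mxE mulr_suml; apply: eq_bigr => a _.
by rewrite cintegralZ// !mxE; ring.
Qed.

Definition unitary_mx U := U *m adj U = 1%:M /\ adj U *m U = 1%:M.

(** The spectral theorem for normal matrices. Only the vanishing off the diagonal is recorded,
    because the eigenvalues are later identified as integrals by [wgram_diag]. *)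
Lemma hermitian_diagonalizable G : adj G = G ->
  exists2 U, unitary_mx U & forall i j, i != j -> (U *m G *m adj U) i j = 0.
Proof.
move=> GH.
have adjE U : adj U = map_mx Num.conj U^T by apply/matrixP => i j; rewrite !mxE.
have /orthomx_spectralP GE : G \is normalmx.
  by apply/normalmxP; rewrite -adjE GH.
set U := spectralmx G in GE *.
have Uu : U \is unitarymx := spectral_unitarymx G.
have U1 : U *m adj U = 1%:M by rewrite adjE; exact/unitarymxP.
exists U.
  by split => //; exact: mulmx1C.
move=> i j ij.
rewrite GE !mulmxA mulmxV ?unitarymx_unit// mul1mx -mulmxA U1 mulmx1.
by rewrite mxE (negPf ij).
Qed.

Lemma wgram_hermitian h psi : measurable_fun setT h -> bounded_fun h ->
  (forall i, in_L2 lam (psi i)) -> adj (wgram h psi) = wgram h psi.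
Proof.
move=> mh bh Lpsi; apply/matrixP => i j; rewrite !mxE -cintegral_conj.
  congr cintegral; apply/funext => x.
  by apply: complex_ext; rewrite !cE /=; ring.
by apply: cintegrable_bounded => //; exact: cintegrable_L2.
Qed.

(** The expansion of [K] holds at every pair of points, since the determinants involve K(x,x), which
    almost everywhere statements about pairs do not control. *)
Definition onb (K : T -> T -> R[i]) psi :=
  [/\ forall i, in_L2 lam (psi i),
      forall i j, cinner lam (psi i) (psi j) = (i == j)%:R &
      forall x y, K x y = \sum_i psi i x * conjc (psi i y)].

Definition density psi i x : R := sqmod (psi i x).

Lemma wgram1 psi i j : wgram (fun=> 1) psi i j = cinner lam (psi i) (psi j).
Proof.
by rewrite mxE; congr cintegral; apply/funext => x; rewrite rmorph1 mul1r.
Qed.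

Lemma bounded_fun_cst (r : R) : bounded_fun (fun _ : T => r).
Proof. by exists `|r|; split => // M /ltW rM x _; rewrite /=. Qed.

Lemma in_L2_change psi U : (forall i, in_L2 lam (psi i)) ->
  forall i, in_L2 lam (change U psi i).
Proof. by move=> Lpsi i; apply: in_L2_sum => j; exact: in_L2Z. Qed.

Lemma onb_change K psi U : onb K psi -> unitary_mx U -> onb K (change U psi).
Proof.
move=> [Lpsi Opsi Kpsi] [U1 U2]; split.
- exact: in_L2_change.
- move=> i j; rewrite -wgram1 wgram_change//; last exact: bounded_fun_cst.
  have -> : wgram (fun=> 1) psi = 1%:M.
    by apply/matrixP => a b; rewrite wgram1 Opsi mxE.
  by rewrite mulmx1 U1 mxE.
- move=> x y; rewrite Kpsi.
  (* Inserting the identity matrix [adj U *m U] turns the old expansion into the new one. *)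
  transitivity (\sum_a \sum_b (adj U *m U) b a * (psi a x * conjc (psi b y))).
    apply: eq_bigr => a _; rewrite (bigD1 a)//= big1 => [|b ba].
      by rewrite U2 mxE eqxx mul1r addr0.
    by rewrite U2 mxE (negPf ba) mul0r.
  transitivity (\sum_i \sum_a \sum_b
      (U i a * psi a x) * conjc (U i b * psi b y)); last first.
    apply: eq_bigr => i _; rewrite /change raddf_sum mulr_suml.
    by apply: eq_bigr => a _; rewrite mulr_sumr.
  rewrite [RHS]exchange_big/=; apply: eq_bigr => a _.
  rewrite [RHS]exchange_big/=; apply: eq_bigr => b _.
  rewrite mxE mulr_suml; apply: eq_bigr => i _.
  by rewrite mxE rmorphM/=; ring.
Qed.

Lemma integrable_density h psi i : measurable_fun setT h -> bounded_fun h ->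
  in_L2 lam (psi i) -> lam.-integrable setT (EFin \o (fun x => h x * density psi i x)).
Proof.
move=> mh bh Li; have [+ _] := cintegrable_bounded mh bh (cintegrable_L2 Li Li).
by apply: eq_integrable => // x _ /=; rewrite mulc_conj /= !mul0r subr0.
Qed.

Lemma wgram_diag h psi i : measurable_fun setT h -> bounded_fun h ->
  wgram h psi i i = C (\int[lam]_x (h x * density psi i x)).
Proof.
move=> mh bh; rewrite mxE; apply: complex_ext; rewrite /cintegral/=.
  by apply: eq_Rintegral => x _; rewrite mulc_conj /= mul0r subr0.
under eq_Rintegral do rewrite mulc_conj /= mul0r mulr0 addr0.
by rewrite Rintegral_cst// mul0r.
Qed.

(** The squared moduli of the entries of a unitary matrix are doubly stochastic, so in any basis the
    diagonal of the form is an average of its eigenvalues. Later arguments see the change of basis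
    only through these weights. *)
Lemma onb_diagonalize K psi h : onb K psi ->
  measurable_fun setT h -> bounded_fun h ->
  exists psi' (w : 'I_N -> 'I_N -> R),
  [/\ onb K psi', forall i j, i != j -> wgram h psi' i j = 0,
      forall a i, 0 <= w a i,
      (forall a, \sum_i w a i = 1) /\ (forall i, \sum_a w a i = 1) &
      forall a, \int[lam]_x (h x * density psi a x) =
         \sum_i w a i * \int[lam]_x (h x * density psi' i x)].
Proof.
move=> opsi mh bh; have [Lpsi _ _] := opsi.
have [U Uu UD] := hermitian_diagonalizable (wgram_hermitian mh bh Lpsi).
have o' := onb_change opsi Uu; have [U1 U2] := Uu.
rewrite -wgram_change// in UD.
exists (change U psi), (fun a i => sqmod (U i a)); split => //.
- by move=> a i; exact: sqmod_ge0.
- split=> [a|i].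
    apply: (@complexI R); rewrite rmorph_sum rmorph1/=.
    move/matrixP: U2 => /(_ a a); rewrite !mxE eqxx mulr1n => <-.
    by apply: eq_bigr => i _; rewrite -mulc_conj mxE mulrC.
  apply: (@complexI R); rewrite rmorph_sum rmorph1/=.
  move/matrixP: U1 => /(_ i i); rewrite !mxE eqxx mulr1n => <-.
  by apply: eq_bigr => a _; rewrite -mulc_conj mxE.
- move=> a; apply: (@complexI R); rewrite -wgram_diag//.
  have -> : wgram h psi = adj U *m wgram h (change U psi) *m U.
    by rewrite wgram_change// !mulmxA U2 mul1mx -mulmxA U2 mulmx1.
  rewrite mxE rmorph_sum/=; apply: eq_bigr => i _.
  rewrite mxE (bigD1 i)//= big1 => [|j ji]; last by rewrite UD ?mulr0.
  rewrite addr0 wgram_diag// [adj U a i]mxE [RHS]rmorphM/= -mulc_conj; ring.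
Qed.

End Frames.

(** * An orthonormal basis representing the kernel pointwise *)

Section KernelBasis.
Context {d : measure_display} {T : measurableType d} {R : realType}.
Variable lam : {measure set T -> \bar R}.
Variables (N : nat) (K : T -> T -> R[i]).
Local Notation C := (real_complex R).

Lemma cintegrable_L2M (g h : T -> R[i]) : in_L2 lam g -> in_L2 lam h ->
  cintegrable lam (fun x => g x * h x).
Proof.
move=> Lg Lh; have := cintegrable_L2 Lg (in_L2_conj Lh).
by under eq_fun do rewrite conjcK.
Qed.

(** The reproducing identity with [x = z] says that |K(y,z)|^2 has the finite integral K(z,z) in
    y. *)
Lemma kernel_in_L2 : projection_kernel lam K N ->
  (forall z, in_L2 lam (fun y => K y z)) /\ (forall x, in_L2 lam (K x)).
Proof.
move=> [mr mi [Kh Kr] _ _].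
have LK z : in_L2 lam (fun y => K y z).
  apply/in_L2P; split.
    split; first exact: (measurable_fun_pair1 z mr).
    exact: (measurable_fun_pair1 z mi).
  have [[+ _] _] := Kr z z; apply: eq_integrable => // y _ /=.
  by rewrite (Kh y z) !cE /sqmod; congr EFin; ring.
split=> // x; have -> : K x = fun y => conjc (K y x) by apply/funext => y; rewrite Kh.
exact: in_L2_conj.
Qed.

(** Integration against [K] turns an almost everywhere identity into one that holds everywhere. The
    images [e i] of the given [u i] are fixed only almost everywhere; their images [v i] are fixed
    at every point. *)
Lemma finite_rank_expansion : projection_kernel lam K N ->
  exists v : 'I_N -> T -> R[i],
  [/\ forall i, in_L2 lam (v i),
      forall i x, integral_operator lam K (v i) x = v i x,
      forall c : 'I_N -> R[i],
        {ae lam, forall x, \sum_i c i * v i x = 0} -> forall i, c i = 0 &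
      exists c : T -> 'I_N -> R[i], forall x z, K x z = \sum_i c z i * v i x].
Proof.
move=> PK; have [LK LK'] := kernel_in_L2 PK.
have [_ _ [_ Kr] [P1 _ P3] [u [Lu indep span]]] := PK.
pose e i := integral_operator lam K (u i).
have Le i : in_L2 lam (e i) by have [] := P1 _ (Lu i).
pose v i := integral_operator lam K (e i).
have Lv i : in_L2 lam (v i) by have [] := P1 _ (Le i).
have ve : {ae lam, forall x, forall i, v i x = e i x}.
  by apply: filter_forall => i; exact: P3.
exists v; split => //.
- move=> i x; apply: cintegral_ae.
  + by apply: cmeasurableM; [have [] := LK' x|have [] := Lv i].
  + by apply: cmeasurableM; [have [] := LK' x|have [] := Le i].
  + by apply: filterS ve => y ->.
- move=> c c0; apply: indep; apply: filterS2 ve c0 => x vx cx.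
  by rewrite -[RHS]cx; apply: eq_bigr => i _; rewrite vx.
- suff /choice[c cP] : forall z, exists c : 'I_N -> R[i],
      forall x, K x z = \sum_i c i * v i x by exists c => x z; exact: cP.
  (* By the reproducing identity the column K(.,z) is its own image, so it is almost everywhere a
     combination of the [e i]; applying the operator once more gives the same combination of the
     [v i] everywhere. *)
  move=> z; have [c cP] := span _ (LK z).
  exists c => x; have [_ <-] := Kr x z.
  transitivity (cintegral lam (fun y => \sum_i c i * (K x y * e i y))).
    apply: cintegral_ae.
    + by apply: cmeasurableM; [have [] := LK' x|have [] := LK z].
    + have : in_L2 lam (fun y => \sum_i c i * e i y).
        by apply: in_L2_sum => i; exact: in_L2Z.
      case=> m _; have := cmeasurableM (LK' x).1 m.
      under eq_fun do rewrite mulr_sumr.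
      by under eq_fun do under eq_bigr do rewrite mulrCA.
    + apply: filterS cP => y; rewrite /integral_operator (Kr y z).2 => ->.
      by rewrite mulr_sumr; apply: eq_bigr => i _; rewrite /e/integral_operator; ring.
  rewrite cintegral_sum => [|i]; last first.
    by apply: cintegrableZ; exact: cintegrable_L2M.
  by apply: eq_bigr => i _; rewrite cintegralZ//; exact: cintegrable_L2M.
Qed.

(** Diagonalising the Gram matrix of [v] gives orthogonal functions [w], and dividing by their norms
    makes them orthonormal. That [w] is fixed by the operator then forces the coefficients in the
    expansion of [K]. *)
Lemma projection_kernel_onb : projection_kernel lam K N ->
  exists psi : 'I_N -> T -> R[i], onb lam K psi.
Proof.
move=> PK; have [v [Lv Kv indep [c Kc]]] := finite_rank_expansion PK.
have [_ LK'] := kernel_in_L2 PK; have [_ _ [Kh _] _ _] := PK.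
have m1 : measurable_fun [set: T] (fun=> 1 : R) by exact: measurable_cst.
have b1 := @bounded_fun_cst _ T R 1.
have [U [U1 U2] UD] := hermitian_diagonalizable (wgram_hermitian m1 b1 Lv).
rewrite -wgram_change// in UD.
set w := change U v in UD.
have Lw : forall i, in_L2 lam (w i) by exact: in_L2_change.
pose D i := \int[lam]_x density w i x.
have DE i j : cinner lam (w i) (w j) = C (D i) * (i == j)%:R.
  rewrite -wgram1; have [->|ij] := eqVneq i j; last by rewrite UD// mulr0.
  by rewrite wgram_diag// mulr1; congr C; apply: eq_Rintegral => x _; rewrite mul1r.
(* If the norm vanished, [w i] would be null almost everywhere, and independence of [v] would
   annihilate row [i] of the unitary matrix [U]. *)
have Dgt0 i : 0 < D i.
  rewrite lt_def Rintegral_ge0 ?andbT => [|x _]; last exact: sqmod_ge0.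
  apply/eqP => Di0; have /cinner_norm0 : cinner lam (w i) (w i) = 0.
    by rewrite DE Di0 mul0r.
  move=> /(_ (Lw i)) /indep Ui0.
  move/matrixP: U1 => /(_ i i); rewrite !mxE eqxx big1 => [/eqP|j _].
    by rewrite mulr1n eq_sym oner_eq0.
  by rewrite Ui0 mul0r.
pose c' z j := \sum_a c z a * conjc (U j a).
have Kc' x z : K x z = \sum_j c' z j * w j x.
  rewrite Kc.
  transitivity (\sum_a \sum_b c z a * (adj U *m U) a b * v b x).
    apply: eq_bigr => a _; rewrite (bigD1 a)//= big1 => [|b ba].
      by rewrite U2 mxE eqxx mulr1 addr0.
    by rewrite U2 mxE eq_sym (negPf ba) mulr0 mul0r.
  transitivity (\sum_j \sum_a \sum_b c z a * conjc (U j a) * (U j b * v b x)).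
    rewrite [RHS]exchange_big/=; apply: eq_bigr => a _.
    rewrite [RHS]exchange_big/=; apply: eq_bigr => b _.
    rewrite mxE mulr_sumr mulr_suml; apply: eq_bigr => j _.
    by rewrite mxE; ring.
  apply: eq_bigr => j _; rewrite /c' mulr_suml; apply: eq_bigr => a _.
  by rewrite /w /change mulr_sumr.
(* Pair K(.,z) with [w j] in two ways: hermitian symmetry and the fixed-point property give the left
   side, orthogonality of [w] gives the right side. *)
have c'E z j : conjc (w j z) = c' z j * C (D j).
  have Kw : integral_operator lam K (w j) z = w j z.
    rewrite /integral_operator /w /change.
    transitivity (cintegral lam (fun y => \sum_b U j b * (K z y * v b y))).
      congr cintegral; apply/funext => y; rewrite mulr_sumr.
      by apply: eq_bigr => b _; ring.
    rewrite cintegral_sum => [|b]; last by apply: cintegrableZ; exact: cintegrable_L2M.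
    apply: eq_bigr => b _; rewrite cintegralZ; last exact: cintegrable_L2M.
    by congr (_ * _); exact: Kv.
  rewrite -Kw -cintegral_conj; last exact: cintegrable_L2M.
  transitivity (cintegral lam (fun y => \sum_i c' z i * (w i y * conjc (w j y)))).
    congr cintegral; apply/funext => y.
    by rewrite rmorphM/= -Kh Kc' mulr_suml; apply: eq_bigr => i _; ring.
  rewrite cintegral_sum => [|i]; last by apply: cintegrableZ; exact: cintegrable_L2.
  rewrite (bigD1 j)//= big1 => [|i ij].
    by rewrite cintegralZ ?addr0; [rewrite [cintegral _ _]DE eqxx mulr1|exact: cintegrable_L2].
  by rewrite cintegralZ; [rewrite [cintegral _ _]DE (negPf ij) !mulr0|exact: cintegrable_L2].
pose s i := (Num.sqrt (D i))^-1.
have sD i : s i * s i * D i = 1.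
  rewrite /s -{3}[D i]sqr_sqrtr ?ltW// expr2.
  by field; rewrite sqrtr_eq0 -ltNge.
exists (fun i x => C (s i) * w i x); split.
- by move=> i; exact: in_L2Z.
- move=> i j; transitivity (C (s i) * C (s j) * cinner lam (w i) (w j)).
    rewrite -cintegralZ; last exact: cintegrable_L2.
    congr cintegral; apply/funext => x.
    by apply: complex_ext; rewrite !cE /=; ring.
  rewrite DE; have [->|ij] := eqVneq i j; last by rewrite !mulr0.
  by rewrite mulr1 -!rmorphM/= sD.
- move=> x y; rewrite Kc'; apply: eq_bigr => j _.
  have -> : conjc (C (s j) * w j y) = C (s j) * conjc (w j y).
    by apply: complex_ext; rewrite !cE /=; ring.
  rewrite c'E.
  transitivity (C (s j * s j * D j) * (c' y j * w j x)); first by rewrite sD mul1r.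
  by rewrite !rmorphM/=; ring.
Qed.

End KernelBasis.

(** * The Fredholm expansion *)

Section Fredholm.
Context {d : measure_display} {T : measurableType d} {R : realType}.
Variable lam : {measure set T -> \bar R}.
Local Notation C := (real_complex R).

(** Linearity one variable at a time: integrating the inner variables leaves constants, which join
    the coefficients of functions of the outermost variable. *)
Lemma iterated_integral_sum_prod (I : Type) (s : seq I) (k : nat) (c : I -> R[i])
    (h : I -> 'I_k -> T -> R[i]) :
  (forall a i, cintegrable lam (h a i)) ->
  iterated_integral lam (fun t : k.-tuple T =>
    cRe (\sum_(a <- s) c a * \prod_(i < k) h a i (tnth t i))) =
  cRe (\sum_(a <- s) c a * \prod_(i < k) cintegral lam (h a i)).
Proof.
elim: k c h => [|k IH] c h ih /=.
  by congr cRe; apply: eq_bigr => a _; rewrite !big_ord0.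
transitivity (\int[lam]_x cRe (\sum_(a <- s)
    (\prod_(i < k) cintegral lam (h a (lift ord0 i)) * c a) * h a ord0 x)).
  apply: eq_Rintegral => x _.
  have := IH (fun a => c a * h a ord0 x) (fun a i => h a (lift ord0 i))
    (fun a i => ih a (lift ord0 i)).
  under [in RHS]eq_bigr do rewrite mulrC mulrA.
  move=> <-; congr iterated_integral; apply/funext => t; congr cRe.
  apply: eq_bigr => a _; rewrite big_ord_recl tnth0 mulrA; congr (_ * _).
  by apply: eq_bigr => i _; rewrite tnthS.
have iF a := cintegrableZ (\prod_(i < k) cintegral lam (h a (lift ord0 i)) * c a)
  (ih a ord0).
apply: (etrans (congr1 (@cRe R) (cintegral_sum s iF))).
congr cRe; apply: eq_bigr => a _.
by rewrite cintegralZ// big_ord_recl; ring.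
Qed.

Variables (N : nat) (K : T -> T -> R[i]) (psi : 'I_N -> T -> R[i]) (h : T -> R).
Hypothesis opsi : onb lam K psi.
Hypothesis mh : measurable_fun setT h.
Hypothesis bh : bounded_fun h.
Hypothesis diag : forall i j, i != j -> wgram lam h psi i j = 0.

Let mu i := \int[lam]_x (h x * density psi i x).

(** The Leibniz formula with each entry expanded in the basis. The inverse permutation appears
    because all factors evaluated at the same point are gathered, as integrating variable by
    variable requires. *)
Lemma kernel_det_expansion k (t : k.-tuple T) :
  (\prod_(i < k) h (tnth t i)) *
    cRe (\det (\matrix_(i < k, j < k) K (tnth t i) (tnth t j))) =
  cRe (\sum_(a : {ffun 'I_k -> 'I_N} * {perm 'I_k})
    (-1) ^+ (odd_perm a.2) * \prod_(i < k)
       (C (h (tnth t i)) * (psi (a.1 i) (tnth t i)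
          * conjc (psi (a.1 (a.2^-1%g i)) (tnth t i))))).
Proof.
have [_ _ Kpsi] := opsi.
have CM (r : R) (z : R[i]) : r * cRe z = cRe (C r * z).
  by rewrite cE /= mul0r subr0.
rewrite CM rmorph_prod/=; congr cRe.
rewrite -(pair_bigA _ (fun (g : {ffun 'I_k -> 'I_N}) (s : {perm 'I_k}) => (-1) ^+ (odd_perm s) * \prod_(i < k)
       (C (h (tnth t i)) * (psi (g i) (tnth t i)
          * conjc (psi (g (s^-1%g i)) (tnth t i))))))/= exchange_big/=.
rewrite mulr_sumr; apply: eq_bigr => s _.
rewrite mulrCA -mulr_sumr; congr (_ * _).
transitivity (\prod_(i < k) C (h (tnth t i)) *
   \prod_(i < k) \sum_j psi j (tnth t i) * conjc (psi j (tnth t (s i)))).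
  by congr (_ * _); apply: eq_bigr => i _; rewrite mxE Kpsi.
rewrite bigA_distr_bigA mulr_sumr; apply: eq_bigr => g _.
rewrite !big_split/=; congr (_ * (_ * _)).
rewrite [RHS](reindex_inj (@perm_inj _ s))/=.
by apply: eq_bigr => i _; rewrite permK.
Qed.

(** For fixed [g] the sum over permutations reassembles into a determinant of entries of [wgram].
    Two equal rows kill it when [g] is not injective; otherwise the matrix is diagonal. *)
Lemma iterated_integral_det k :
  iterated_integral lam (fun t : k.-tuple T =>
    (\prod_(i < k) h (tnth t i)) *
    cRe (\det (\matrix_(i < k, j < k) K (tnth t i) (tnth t j)))) =
  \sum_(g : {ffun 'I_k -> 'I_N} | injectiveb g) \prod_i mu (g i).
Proof.
have [Lpsi _ _] := opsi.
transitivity (iterated_integral lam (fun t : k.-tuple T =>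
  cRe (\sum_(a : {ffun 'I_k -> 'I_N} * {perm 'I_k})
    (-1) ^+ (odd_perm a.2) * \prod_(i < k)
       (C (h (tnth t i)) * (psi (a.1 i) (tnth t i)
          * conjc (psi (a.1 (a.2^-1%g i)) (tnth t i))))))).
  by congr iterated_integral; apply/funext => t; exact: kernel_det_expansion.
rewrite (@iterated_integral_sum_prod _ _ _ (fun a : {ffun 'I_k -> 'I_N} * {perm 'I_k} =>
    (-1) ^+ (odd_perm a.2)) (fun a i x => C (h x) * (psi (a.1 i) x
          * conjc (psi (a.1 (a.2^-1%g i)) x)))); last first.
  by move=> a i; apply: cintegrable_bounded => //; exact: cintegrable_L2.
transitivity (cRe (\sum_(g : {ffun 'I_k -> 'I_N})
   \det (\matrix_(i, j) wgram lam h psi (g i) (g j)))).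
  congr cRe; rewrite -(pair_bigA _ (fun (g : {ffun 'I_k -> 'I_N}) (s : {perm 'I_k}) =>
    (-1) ^+ (odd_perm s) * \prod_i cintegral lam
     (fun x => C (h x) * (psi (g i) x * conjc (psi (g (s^-1%g i)) x)))))/=.
  apply: eq_bigr => g _; rewrite [LHS](reindex_inj invg_inj)/=.
  apply: eq_bigr => s _; rewrite odd_permV invgK; congr (_ * _).
  by apply: eq_bigr => i _; rewrite !mxE.
rewrite [in LHS](bigID (fun g : {ffun 'I_k -> 'I_N} => injectiveb g))/=.
rewrite [X in cRe (_ + X)]big1 ?addr0.
  transitivity (cRe (C (\sum_(g : {ffun 'I_k -> 'I_N} | injectiveb g)
    \prod_i mu (g i)))); last by [].
  congr cRe; rewrite rmorph_sum/=; apply: eq_bigr => g /injectiveP ginj.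
  rewrite rmorph_prod/=.
  have -> : \matrix_(i, j) wgram lam h psi (g i) (g j) =
     diag_mx (\row_i C (mu (g i))).
    apply/matrixP => i j; rewrite [LHS]mxE [RHS]mxE [(\row__ _) _ _]mxE.
    have [->|ij] := eqVneq i j; first by rewrite wgram_diag// mulr1n.
    by rewrite diag ?mulr0n// (inj_eq ginj).
  by rewrite det_diag; apply: eq_bigr => i _; rewrite mxE.
move=> g /injectivePn[i [j ij gij]].
by apply: (determinant_alternate ij) => m; rewrite !mxE gij.
Qed.

(** Each subset of size [k] is the image of exactly k! injections; this factor cancels the one in
    the Fredholm sum. *)
Lemma sum_injective_prod (nu : 'I_N -> R) k :
  \sum_(g : {ffun 'I_k -> 'I_N} | injectiveb g) \prod_i nu (g i) =
  k`!%:R * \sum_(J : {set 'I_N} | #|J| == k) \prod_(j in J) nu j.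
Proof.
rewrite (partition_big (fun g : {ffun 'I_k -> 'I_N} => (g @: [set: 'I_k]%SET)%SET)
  (fun J : {set 'I_N} => #|J| == k))/=; last first.
  by move=> g /injectiveP ginj; rewrite card_imset// cardsT card_ord.
rewrite mulr_sumr; apply: eq_bigr => J /eqP Jk.
transitivity (\sum_(g : {ffun 'I_k -> 'I_N} | g \in [set g in ffun_on (mem J) | injectiveb g]%SET)
    \prod_(j in J) nu j).
  apply: eq_big => g.
    rewrite inE; apply/andP/andP => -[].
      move=> gi /eqP gJ; split=> //; apply/ffun_onP => x.
      by rewrite -gJ; apply: imset_f; rewrite inE.
    move=> /ffun_onP gJ gi; split=> //; rewrite eqEcard; apply/andP; split.
      by apply/fintype.subsetP => _ /imsetP[x _ ->]; exact: gJ.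
    by rewrite card_imset ?cardsT ?card_ord ?Jk//; exact/injectiveP.
  move=> /andP[/injectiveP gi /eqP gJ]; rewrite -gJ big_imset/=.
    by apply: eq_bigl => x; rewrite inE.
  by move=> x y _ _; exact: gi.
by rewrite sumr_const card_inj_ffuns_on card_ord Jk ffactnn mulr_natl.
Qed.

Lemma fredholm_sum_prod :
  \sum_(0 <= k < N.+1) (k`!%:R)^-1 * iterated_integral lam (fun t : k.-tuple T =>
    (\prod_(i < k) h (tnth t i)) *
    cRe (\det (\matrix_(i < k, j < k) K (tnth t i) (tnth t j)))) =
  \prod_(i < N) (1 + mu i).
Proof.
under eq_bigr do rewrite iterated_integral_det sum_injective_prod mulrA
  mulVf ?pnatr_eq0 ?gtn_eqF ?fact_gt0// mul1r.
under [RHS]eq_bigr do rewrite addrC.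
rewrite bigA_distr/= big_mkord.
(* Group the subsets by size; [inord] never falls back to its default because a subset has at most
   [N] elements. *)
rewrite [RHS](partition_big (fun J : {set 'I_N} => inord #|J| : 'I_N.+1) predT)//=.
apply: eq_bigr => k _; apply: eq_big => J.
  have JN : (#|J| < N.+1)%N by rewrite ltnS -[X in (_ <= X)%N]card_ord max_card.
  by rewrite -val_eqE/= inordK.
by move=> _; rewrite [LHS]big_mkcond.
Qed.

End Fredholm.

(** * Moments of linear statistics *)

Section LinearStatistics.
Import HBNNSimple.
Context {d d' : measure_display} {T : measurableType d} {R : realType}.
Context {Omega : measurableType d'}.
Variable X : Omega -> seq T.
Hypothesis rX : random_configuration X.
Implicit Types (g h : T -> R).

Lemma measurable_count (B : set T) : measurable B ->
  measurable_fun setT (fun w => (count (fun x => x \in B) (X w))%:R : R).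
Proof.
move=> mB; apply: (@measurableT_comp _ _ _ _ _ _ (fun n : nat => n%:R : R)) (rX mB).
by move=> _ Y _; exact: I.
Qed.

(** Only counts of points in sets are known to be measurable. A simple function gives a finite
    combination of counts, and pointwise limits pass through the finite sum over the
    configuration. *)
Lemma measurable_linear_statistic_ge0 g : measurable_fun setT g ->
  (forall x, 0 <= g x) -> measurable_fun setT (linear_statistic X g).
Proof.
move=> mg g0; apply/measurable_EFinP.
have mg' : measurable_fun setT (EFin \o g) by exact/measurable_EFinP.
pose a n : {nnsfun T >-> R} := nnsfun_approx measurableT mg' n.
apply: (emeasurable_fun_cvg (fun n w => (linear_statistic X (a n) w)%:E)).
  move=> n; apply/measurable_EFinP.
  have -> : linear_statistic X (a n) = fun w => \sum_(y <- fset_set (range (a n)))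
      y * (count (fun x => x \in a n @^-1` [set y]) (X w))%:R.
    apply/funext => w; rewrite /linear_statistic.
    under eq_bigr do rewrite fimfunE fsbig_finite//=.
    rewrite exchange_big/=; apply: eq_bigr => y _.
    rewrite -mulr_sumr; congr (_ * _).
    rewrite -sum1_count natr_sum [RHS]big_mkcond/=.
    by apply: eq_bigr => x _; rewrite indicE; case: (_ \in _).
  apply: measurable_sum => y; apply: measurable_funM; first exact: measurable_cst.
  by apply: measurable_count; exact: measurable_sfunP.
move=> w _; rewrite /linear_statistic /=.
elim: (X w) => [|x s IH].
  under eq_fun do rewrite big_nil; rewrite big_nil; exact: cvg_cst.
under eq_fun do rewrite big_cons EFinD; rewrite big_cons EFinD.
apply: cvgeD => //.
exact: (cvg_nnsfun_approx measurableT mg' (fun x _ => g0 x) (x := x)).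
Qed.

Lemma measurable_linear_statistic g : measurable_fun setT g ->
  measurable_fun setT (linear_statistic X g).
Proof.
move=> mg.
have -> : linear_statistic X g =
  fun w => linear_statistic X (fun x => Num.max (g x) 0) w
         - linear_statistic X (fun x => Num.max (- g x) 0) w.
  apply/funext => w; rewrite /linear_statistic -sumrB; apply: eq_bigr => x _.
  by rewrite !maxEle; case: ifP; case: ifP; lra.
apply: measurable_funB; apply: measurable_linear_statistic_ge0.
- by apply: measurable_maxr => //; exact: measurable_cst.
- by move=> x; rewrite le_max lexx orbT.
- by apply: measurable_maxr; [exact: measurableT_comp|exact: measurable_cst].
- by move=> x; rewrite le_max lexx orbT.
Qed.

Lemma prod_eq_expR g w : (forall x, 0 < 1 + g x) ->
  \prod_(x <- X w) (1 + g x) = expR (linear_statistic X (fun x => ln (1 + g x)) w).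
Proof.
move=> g1; rewrite /linear_statistic; elim: (X w) => [|x s IH].
  by rewrite !big_nil expR0.
by rewrite !big_cons expRD lnK ?IH// posrE.
Qed.

Lemma measurable_prod g : measurable_fun setT g -> (forall x, 0 < 1 + g x) ->
  measurable_fun setT (fun w => \prod_(x <- X w) (1 + g x)).
Proof.
move=> mg g1; under eq_fun do rewrite prod_eq_expR//.
apply: measurableT_comp => //; apply: measurable_linear_statistic.
by apply: measurableT_comp => //; apply: measurable_funD => //; exact: measurable_cst.
Qed.

End LinearStatistics.

(** * Second-order expansion of finite products *)

Section ElementarySymmetric.
Context {R : realType}.
Implicit Types (s : seq R) (r a b C : R).

Definition sum1 s : R := \sum_(a <- s) a.
Definition sum2 s : R := \sum_(a <- s) a ^+ 2.
(** The second elementary symmetric polynomial, the coefficient of r^2 in prod (1 + r a). Newton's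
    form expresses it through linear statistics and leads directly to the variance. *)
Definition elem2 s : R := (sum1 s ^+ 2 - sum2 s) / 2.
(** The factor 2 closes the induction on the remainder: (1 + |a|) M + |a| M = (1 + 2|a|) M. *)
Definition majorant s : R := \prod_(a <- s) (1 + 2 * `|a|).

Lemma prod_second_order s : [/\ 1 <= majorant s,
    `|sum1 s| <= majorant s, `|elem2 s| <= majorant s &
    forall r, 0 <= r <= 1 ->
      `|\prod_(a <- s) (1 + r * a)| <= majorant s /\
      `|\prod_(a <- s) (1 + r * a) - 1 - r * sum1 s - r ^+ 2 * elem2 s|
        <= r ^+ 3 * majorant s].
Proof.
elim: s => [|a s [M1 s1 e2 IH]].
  rewrite /elem2 /majorant /sum1 /sum2 !big_nil expr0n subr0 mul0r normr0.
  split=> // r /andP[r0 r1]; rewrite !big_nil normr1 subrr !mulr0 !subr0 normr0; split=> //.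
  by rewrite mulr1 exprn_ge0.
have Sa : sum1 (a :: s) = sum1 s + a by rewrite /sum1 big_cons addrC.
have Ea : elem2 (a :: s) = elem2 s + a * sum1 s.
  by rewrite /elem2 Sa /sum2 big_cons; field.
have Ma : majorant (a :: s) = (1 + 2 * `|a|) * majorant s by rewrite /majorant big_cons.
have a0 := normr_ge0 a.
have aM : 0 <= `|a| * majorant s by rewrite mulr_ge0// (le_trans _ M1).
have aaM : `|a| <= `|a| * majorant s by rewrite ler_peMr.
have eM : `|a| * `|elem2 s| <= `|a| * majorant s by rewrite ler_wpM2l.
have sM : `|a| * `|sum1 s| <= `|a| * majorant s by rewrite ler_wpM2l.
rewrite Sa Ea Ma; split.
- nra.
- by rewrite (le_trans (ler_normD _ _))//; lra.
- by rewrite (le_trans (ler_normD _ _))// (normrM a); lra.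
- move=> r /andP[r0 r1]; have [P0 P1] := IH r (introT andP (conj r0 r1)).
  rewrite big_cons; split.
    rewrite normrM ler_pM// (le_trans (ler_normD _ _))// normr1 lerD2l normrM ger0_norm//.
    by rewrite ler_wpM2r// (le_trans r1)// ler1n.
  set p := \prod_(j <- s) (1 + r * j) in P0 P1 *.
  (* A new factor multiplies the old remainder by 1 + r a and adds just one term of order 3, namely
     r^3 a e_2. *)
  rewrite [X in `|X|](_ : _ = (1 + r * a) * (p - 1 - r * sum1 s - r ^+ 2 * elem2 s)
     + r ^+ 3 * (a * elem2 s)); last by ring.
  have r3 : 0 <= r ^+ 3 by rewrite exprn_ge0.
  apply: (@le_trans _ _ ((1 + `|a|) * (r ^+ 3 * majorant s) + r ^+ 3 * (`|a| * majorant s))).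
    rewrite (le_trans (ler_normD _ _))// lerD//.
      rewrite normrM ler_pM// (le_trans (ler_normD _ _))// normr1 lerD2l normrM ger0_norm//.
      by rewrite ler_piMl.
    by rewrite normrM (ger0_norm r3) ler_wpM2l// normrM.
  by rewrite le_eqVlt; apply/orP; left; apply/eqP; ring.
Qed.

Lemma small_eq0 a b r0 C : 0 < r0 ->
  (forall r, 0 < r <= r0 -> `|a + r * b| <= r * C) -> a = 0.
Proof.
move=> r0_gt0 H; apply/eqP/negPn/negP => a0.
have C0 : 0 <= C.
  have : 0 <= r0 * C by apply: le_trans (H r0 _); rewrite ?r0_gt0 ?lexx.
  by rewrite pmulr_rge0.
have ap : 0 < `|a| by rewrite normr_gt0.
have b0 := normr_ge0 b.
have D0 : 0 < 2 * (`|b| + C + 1) by lra.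
(* Small enough that r (|b| + C) is at most |a|/2, which contradicts |a| <= r (|b| + C). *)
pose r := Num.min r0 (`|a| / (2 * (`|b| + C + 1))).
have rp : 0 < r by rewrite lt_min r0_gt0 divr_gt0.
have rr : r <= r0 by rewrite ge_min lexx.
have ra : r * (2 * (`|b| + C + 1)) <= `|a| by rewrite -ler_pdivlMr// ge_min lexx orbT.
have := H r (introT andP (conj rp rr)).
have : `|a| <= `|a + r * b| + r * `|b|.
  rewrite -{2}(ger0_norm (ltW rp)) -normrM -[X in `|X| <= _](addrK (r * b)).
  by rewrite (le_trans (ler_normB _ _)).
by nra.
Qed.

(** Two quadratic approximations with cubic error have the same coefficients: compare them at order
    1, then at order 2. *)
Lemma second_order_unique s m1 m2 r0 C : 0 < r0 <= 1 ->
  (forall r, 0 < r <= r0 ->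
    `|\prod_(a <- s) (1 + r * a) - 1 - r * m1 - r ^+ 2 * m2| <= r ^+ 3 * C) ->
  m1 = sum1 s /\ m2 = elem2 s.
Proof.
move=> /andP[r0p r01] H; have [M1 s1 e2 ex] := prod_second_order s.
set M := majorant s in M1 s1 e2 ex.
have {ex}H r : 0 < r <= r0 ->
    `|(m1 - sum1 s) + r * (m2 - elem2 s)| <= r ^+ 2 * (C + M).
  move=> /andP[rp rr]; have [|_ ] := ex r; first by rewrite ltW// (le_trans rr).
  have := H r (introT andP (conj rp rr)).
  set p := \prod_(_ <- _) _ => A B; rewrite -(ler_pM2l rp) -{1}(gtr0_norm rp) -normrM.
  rewrite [X in `|X|](_ : _ = (p - 1 - r * sum1 s - r ^+ 2 * elem2 s)
    - (p - 1 - r * m1 - r ^+ 2 * m2)); last by ring.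
  rewrite (le_trans (ler_normB _ _))//.
  rewrite [leRHS](_ : _ = r ^+ 3 * M + r ^+ 3 * C); last by ring.
  exact: lerD.
have C0 : 0 <= C + M.
  have : 0 <= r0 ^+ 2 * (C + M) by apply: le_trans (H r0 _); rewrite ?r0p ?lexx.
  by rewrite pmulr_rge0// exprn_gt0.
have /eqP E1 : m1 - sum1 s = 0.
  apply: (@small_eq0 _ (m2 - elem2 s) r0 (C + M)) => // r rr.
  rewrite (le_trans (H r rr))// ler_wpM2r// expr2; case/andP: rr => rp rr.
  by rewrite ler_piMr ?(le_trans rr)// ltW.
move: E1; rewrite subr_eq0 => /eqP E1; split => //.
apply/eqP; rewrite -subr_eq0; apply/eqP.
apply: (@small_eq0 _ 0 r0 (C + M)) => // r rr; have /andP[rp _] := rr.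
have := H r rr; rewrite E1 subrr add0r mulr0 addr0 normrM gtr0_norm//.
by rewrite expr2 -mulrA ler_pM2l.
Qed.

End ElementarySymmetric.

Section BoundedFunctions.
Context {T : Type} {R : realType}.
Implicit Types h : T -> R.

Lemma bounded_funP h : bounded_fun h <-> exists M, forall x, `|h x| <= M.
Proof.
split=> [[M [_ hM]]|[M hM]].
  by exists (`|M| + 1) => x; apply: hM => //; rewrite ltr_pwDr// ler_norm.
by exists M; split=> [|r /ltW Mr x _]; [exact: num_real|exact: le_trans (hM x) Mr].
Qed.

End BoundedFunctions.

(** * Moments extracted from the product formula *)

Section Moments.
Context {d d' : measure_display} {T : measurableType d} {R : realType}.
Context {Omega : measurableType d'}.
Variables (P : probability Omega R) (X : Omega -> seq T).
Hypothesis rX : random_configuration X.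
Variable h : T -> R.
Hypothesis mh : measurable_fun setT h.
Hypothesis bh : bounded_fun h.
Hypothesis iQ : P.-integrable setT
  (EFin \o (fun w => \prod_(x <- X w) (1 + 2 * `|h x|))).

Local Notation values w := (map h (X w)).

Let majorantE w : majorant (values w) = \prod_(x <- X w) (1 + 2 * `|h x|).
Proof. by rewrite /majorant big_map. Qed.

Let iM : P.-integrable setT (EFin \o (fun w => majorant (values w))).
Proof. by apply: eq_integrable iQ => // w _ /=; rewrite majorantE. Qed.

Lemma linear_statistic_sum1 w : linear_statistic X h w = sum1 (values w).
Proof. by rewrite /sum1 big_map. Qed.

Lemma linear_statistic_sum2 w :
  linear_statistic X (fun x => h x ^+ 2) w = sum2 (values w).
Proof. by rewrite /sum2 big_map. Qed.

Lemma integrable_linear_statistic :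
  P.-integrable setT (EFin \o linear_statistic X h).
Proof.
apply: (integrable_dominated (measurable_linear_statistic rX mh) iM) => w.
by have [_ + _ _] := prod_second_order (values w); rewrite linear_statistic_sum1.
Qed.

Let e2 w := elem2 (values w).

Lemma integrable_elem2 : P.-integrable setT (EFin \o e2).
Proof.
apply: (integrable_dominated _ iM) => [|w]; last by have [] := prod_second_order (values w).
have -> : e2 = fun w => (linear_statistic X h w ^+ 2 -
    linear_statistic X (fun x => h x ^+ 2) w) * 2^-1.
  by apply/funext => w; rewrite linear_statistic_sum1 linear_statistic_sum2.
apply: measurable_funM; last exact: measurable_cst.
apply: measurable_funB; first exact/measurable_funX/measurable_linear_statistic.
exact/measurable_linear_statistic/measurable_funX.
Qed.

(** Taking expectations in the expansion of [prod_second_order] gives a quadratic approximation of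
    the polynomial attached to [s], with error r^3 times the mean of the majorant. *)
Lemma moments_of_product_formula (s : seq R) :
  (forall r : R, ('E_P[fun w => (\prod_(x <- X w) (1 + r * h x))%R])%E =
     (\prod_(a <- s) (1 + r * a))%:E) ->
  \int[P]_w linear_statistic X h w = sum1 s /\ \int[P]_w e2 w = elem2 s.
Proof.
move=> Eh; have [M [M0 hM]] : exists M, 0 <= M /\ forall x, `|h x| <= M.
  have [M hM] := (bounded_funP h).1 bh; exists `|M|; split=> // x.
  exact: le_trans (hM x) (ler_norm M).
(* For r <= r0 one has |r h| < 1, so every factor 1 + r h is positive and [measurable_prod]
   applies. *)
pose r0 := (1 + M)^-1; have r0p : 0 < r0 by rewrite invr_gt0; lra.
have r01 : r0 <= 1 by rewrite invf_le1; lra.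
apply: (@second_order_unique _ s _ _ r0 (\int[P]_w majorant (values w))).
  by rewrite r0p.
move=> r /andP[rp rr].
have r1 : 0 <= r <= 1 by rewrite ltW// (le_trans rr).
pose p w := \prod_(x <- X w) (1 + r * h x).
have pE w : p w = \prod_(a <- values w) (1 + r * a) by rewrite big_map.
have ip : P.-integrable setT (EFin \o p).
  apply: (integrable_dominated _ iM) => [|w]; last first.
    by rewrite pE; have [_ _ _ /(_ r r1)[]] := prod_second_order (values w).
  apply: measurable_prod => //.
    by apply: measurable_funM => //; exact: measurable_cst.
  move=> x; have : `|r * h x| < 1; last by rewrite ltr_norml => /andP[]; lra.
  rewrite normrM gtr0_norm// (le_lt_trans (y := r0 * M))//.
    by rewrite ler_pM// ?ltW.
  by rewrite mulrC ltr_pdivrMr; lra.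
have Ep : \int[P]_w p w = \prod_(a <- s) (1 + r * a).
  by have := Eh r; rewrite unlock /Rintegral => ->.
have iLS := integrable_linear_statistic; have ie2 := integrable_elem2.
have i1 := integrable_scale r iLS.
have i2 := integrable_scale (r ^+ 2) ie2.
have i0 : P.-integrable setT (EFin \o (fun=> 1 : R)).
  exact: finite_measure_integrable_cst.
have Rint1 : \int[P]_w (1 : R) = 1.
  by rewrite Rintegral_cst// mul1r; exact: (congr1 fine (probability_setT P)).
have id1 := integrable_sub ip i0.
have id2 := integrable_sub id1 i1.
have id3 := integrable_sub id2 i2.
have -> : \prod_(a <- s) (1 + r * a) - 1 - r * \int[P]_w linear_statistic X h w
    - r ^+ 2 * \int[P]_w e2 w =
    \int[P]_w (p w - 1 - r * linear_statistic X h w - r ^+ 2 * e2 w).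
  rewrite RintegralB// RintegralB// RintegralB// Ep Rint1.
  by rewrite (RintegralZl r)// (RintegralZl (r ^+ 2)).
rewrite (le_trans (le_normr_Rintegral _ _))// -RintegralZl//.
apply: le_Rintegral => //.
- exact: (integrable_norm id3).
- exact: integrable_scale.
- move=> w _; rewrite pE linear_statistic_sum1.
  by have [_ _ _ /(_ r r1)[]] := prod_second_order (values w).
Qed.

End Moments.

(** * Laplace transform and tails *)

Section Inequalities.
Context {R : realType}.

(* Hadamard's inequality for a positive matrix with eigenvalues [y], whose
   diagonal entries are the averages of [y] against a doubly stochastic matrix. *)
Lemma prod_le_prod_average (N : nat) (w : 'I_N -> 'I_N -> R) (y : 'I_N -> R) :
  (forall a i, 0 <= w a i) -> (forall a, \sum_i w a i = 1) ->
  (forall i, \sum_a w a i = 1) -> (forall i, 0 < y i) ->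
  \prod_i y i <= \prod_a \sum_i w a i * y i.
Proof.
move=> w0 w1 w1' y0.
(* A vanishing average of positive numbers would force all weights of the row to vanish, but they
   sum to 1. *)
have q0 a : 0 < \sum_i w a i * y i.
  rewrite lt_def sumr_ge0 ?andbT => [|i _]; last by rewrite mulr_ge0// ltW.
  apply/eqP => /eqP; rewrite psumr_eq0 => [/allP q0|i _]; last by rewrite mulr_ge0// ltW.
  have /eqP := w1 a; rewrite big1 => [|i _]; first by rewrite eq_sym oner_eq0.
  by have := q0 i (mem_index_enum i); rewrite mulf_eq0 (gt_eqF (y0 i)) orbF => /eqP.
rewrite (eq_bigr (fun i => expR (ln (y i)))) => [|i _]; last by rewrite lnK// posrE.
rewrite [leRHS](eq_bigr (fun a => expR (ln (\sum_i w a i * y i)))) => [|a _]; last first.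
  by rewrite lnK// posrE.
rewrite -!expR_sum ler_expR.
rewrite (eq_bigr (fun i => \sum_a w a i * ln (y i))) => [|i _]; last first.
  by rewrite -mulr_suml w1' mul1r.
rewrite exchange_big/=; apply: ler_sum => a _.
set q := \sum_i w a i * y i.
have qa : 0 < q := q0 a.
(* Jensen's inequality by the tangent of ln at [q]: ln y <= ln q - 1 + y/q, and the corrections
   cancel on average. *)
apply: (@le_trans _ _ (\sum_i (w a i * (ln q - 1) + w a i * y i / q))).
  apply: ler_sum => i _; rewrite -mulrA -mulrDr ler_wpM2l//.
  have := expR_ge1Dx (ln (y i / q)); rewrite lnK ?posrE ?divr_gt0// ln_div ?posrE//.
  by lra.
by rewrite big_split/= -!mulr_suml w1 mul1r divff ?gt_eqF// subrK.
Qed.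

(** Squaring (1 - u/2) e^(u/2) <= 1 bounds e^u by (1 - u/2)^(-2). The remaining polynomial
    inequality has the factor 5/4 - 7u/4 + u^2/2, which is positive for u <= 2/3. *)
Lemma expR_le_quadratic (u : R) : `|u| <= 2 / 3 -> expR u <= 1 + u + 2 * u ^+ 2.
Proof.
rewrite ler_norml => /andP[u1 u2].
have h0 : 0 < 1 - u / 2 by lra.
have e1 : (1 - u / 2) * expR (u / 2) <= 1.
  rewrite -ler_pdivlMr ?expR_gt0// div1r -expRN.
  by rewrite (le_trans _ (expR_ge1Dx _))//; lra.
have e0 := expR_ge0 (u / 2).
have -> : expR u = expR (u / 2) ^+ 2 by rewrite expr2 -expRD; congr expR; lra.
have e2 : (1 - u / 2) ^+ 2 * expR (u / 2) ^+ 2 <= 1.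
  by rewrite -exprMn exprn_ile1// mulr_ge0// ltW.
have p2 : 0 < (1 - u / 2) ^+ 2 by rewrite exprn_gt0.
rewrite -(ler_pM2l p2) (le_trans e2)//.
have uu := sqr_ge0 u.
have : 0 <= u ^+ 2 * (5 / 4 - 7 / 4 * u + u ^+ 2 / 2) by rewrite mulr_ge0//; lra.
set lhs := (X in 0 <= X -> _) => l0.
by rewrite -subr_ge0 [X in 0 <= X](_ : _ = lhs)// /lhs; field.
Qed.

End Inequalities.

(** * Mean and variance of the determinantal process *)

Section Determinantal.
Context {d d' : measure_display} {T : measurableType d} {R : realType}.
Context {Omega : measurableType d'}.
Variables (P : probability Omega R) (X : Omega -> seq T).
Variables (lam : {measure set T -> \bar R}) (N : nat) (K : T -> T -> R[i]).
Hypothesis dpp : determinantal_process P X lam K N.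
Implicit Types (f h : T -> R) (psi : 'I_N -> T -> R[i]).

(** For an orthonormal [psi], the mean of h(xi_i) in the independent model. *)
Definition wmean h psi i : R := \int[lam]_x (h x * density psi i x).

Lemma bounded_fun_comp h (g : R -> R) (M M' : R) :
  (forall x, `|h x| <= M) -> (forall y, `|y| <= M -> `|g y| <= M') ->
  bounded_fun (fun x => g (h x)).
Proof. by move=> hM gM; apply/bounded_funP; exists M' => x; exact: gM. Qed.

Lemma bounded_funZ h (r : R) : bounded_fun h -> bounded_fun (fun x => r * h x).
Proof.
move=> /bounded_funP[M hM]; apply: (bounded_fun_comp (M' := `|r| * M) hM) => y yM.
by rewrite normrM ler_wpM2l.
Qed.

Lemma bounded_fun_sqr h : bounded_fun h -> bounded_fun (fun x => h x ^+ 2).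
Proof.
move=> /bounded_funP[M hM]; apply: (@bounded_fun_comp h (fun y => y ^+ 2) M (M ^+ 2)) => // y yM.
by rewrite normrX lerXn2r// nnegrE (le_trans _ yM).
Qed.

(** A basis that diagonalises the form of [h] diagonalises that of every multiple of [h], so the
    product formula is explicit along the whole line [r * h]. *)
Lemma expectation_prod_onb psi h : onb lam K psi ->
  measurable_fun setT h -> bounded_fun h ->
  (forall i j, i != j -> wgram lam h psi i j = 0) -> forall r : R,
  ('E_P[fun w => (\prod_(x <- X w) (1 + r * h x))%R])%E =
  (\prod_i (1 + r * wmean h psi i))%:E.
Proof.
move=> opsi mh bh hdiag r; have [Lpsi _ _] := opsi.
have mrh : measurable_fun setT (fun x => r * h x).
  by apply: measurable_funM => //; exact: measurable_cst.
have brh := bounded_funZ r bh.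
have [_ /(_ _ mrh brh) ->] := dpp; congr EFin.
rewrite (fredholm_sum_prod opsi mrh brh) => [|i j ij].
  apply: eq_bigr => i _; congr (1 + _); rewrite /wmean -RintegralZl//.
    by apply: eq_Rintegral => x _; rewrite mulrA.
  exact: integrable_density.
transitivity (real_complex R r * wgram lam h psi i j); last by rewrite hdiag ?mulr0.
have igh := cintegrable_bounded mh bh (cintegrable_L2 (Lpsi i) (Lpsi j)).
rewrite [LHS]mxE [in RHS]mxE -(cintegralZ _ igh).
by congr cintegral; apply/funext => x; apply: complex_ext; rewrite !cE /=; ring.
Qed.

(** For a nonnegative [h] integrability means finiteness of the expectation, and the defining
    formula gives that expectation a real value. *)
Lemma integrable_prod h : measurable_fun setT h -> bounded_fun h ->
  (forall x, 0 <= h x) ->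
  P.-integrable setT (EFin \o (fun w => \prod_(x <- X w) (1 + h x))).
Proof.
move=> mh bh h0; have [rX /(_ _ mh bh) Eh] := dpp.
have h1 x : 0 < 1 + h x by rewrite ltr_pwDl.
apply/integrableP; split; first exact/measurable_EFinP/measurable_prod.
rewrite (eq_integral (fun w => (\prod_(x <- X w) (1 + h x))%:E)) => [|w _]; last first.
  by rewrite /= ger0_norm// prodr_ge0// => x _; exact: ltW.
by move: Eh; rewrite unlock => ->; exact: ltry.
Qed.

Lemma integrable_majorant h : measurable_fun setT h -> bounded_fun h ->
  P.-integrable setT (EFin \o (fun w => \prod_(x <- X w) (1 + 2 * `|h x|))).
Proof.
move=> mh bh; apply: (@integrable_prod (fun x => 2 * `|h x|)).
- by apply: measurable_funM; [exact: measurable_cst|exact: measurableT_comp].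
- apply: bounded_funZ; have /bounded_funP[M hM] := bh.
  by apply: (bounded_fun_comp (M' := M) hM) => y; rewrite normr_id.
- by move=> x; rewrite mulr_ge0.
Qed.

Lemma wmean1 psi i : onb lam K psi -> wmean (fun=> 1) psi i = 1.
Proof.
move=> [Lpsi Opsi _]; apply: (@complexI R).
rewrite -wgram_diag//; last exact: bounded_fun_cst.
by rewrite wgram1 Opsi eqxx.
Qed.

Lemma le_wmean h h' psi i : onb lam K psi ->
  measurable_fun setT h -> bounded_fun h ->
  measurable_fun setT h' -> bounded_fun h' ->
  (forall x, h x <= h' x) -> wmean h psi i <= wmean h' psi i.
Proof.
move=> [Lpsi _ _] mh bh mh' bh' hh'; apply: le_Rintegral => //.
- exact: integrable_density.
- exact: integrable_density.
- by move=> x _; rewrite ler_wpM2r ?sqmod_ge0.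
Qed.

Lemma wmean_cst c psi i : onb lam K psi -> wmean (fun=> c) psi i = c.
Proof.
move=> opsi; have [Lpsi _ _] := opsi.
rewrite -[RHS]mulr1 -[in RHS](wmean1 i opsi) /wmean -RintegralZl//.
  by apply: eq_Rintegral => x _; rewrite mul1r.
by apply: integrable_density => //; exact: bounded_fun_cst.
Qed.

Lemma wmean_quadratic f psi i (a0 a1 a2 : R) : onb lam K psi ->
  measurable_fun setT f -> bounded_fun f ->
  wmean (fun x => a0 + a1 * f x + a2 * f x ^+ 2) psi i =
  a0 + a1 * wmean f psi i + a2 * wmean (fun x => f x ^+ 2) psi i.
Proof.
move=> opsi mf bf; have [Lpsi _ _] := opsi.
have i0 := integrable_density (measurable_cst (1 : R)) (bounded_fun_cst 1) (Lpsi i).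
have i1 := integrable_density mf bf (Lpsi i).
have i2 := integrable_density (measurable_funX 2 mf) (bounded_fun_sqr bf) (Lpsi i).
have j0 := integrable_scale a0 i0.
have j1 := integrable_scale a1 i1.
have j2 := integrable_scale a2 i2.
have j01 := integrable_add j0 j1.
rewrite -[a0 in RHS]mulr1 -[1 in RHS](wmean1 i opsi) /wmean.
rewrite -(RintegralZl a0)// -(RintegralZl a1)// -(RintegralZl a2)//.
rewrite -RintegralD// -RintegralD//.
by apply: eq_Rintegral => x _ /=; ring.
Qed.

(** The variance of f(xi_i). *)
Definition wvar f psi i : R := wmean (fun x => f x ^+ 2) psi i - wmean f psi i ^+ 2.

Lemma expectation_linear_statistic f psi : onb lam K psi ->
  measurable_fun setT f -> bounded_fun f ->
  (forall i j, i != j -> wgram lam f psi i j = 0) ->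
  P.-integrable setT (EFin \o linear_statistic X f) /\
  \int[P]_w linear_statistic X f w = \sum_i wmean f psi i.
Proof.
move=> opsi mf bf fdiag; have rX := dpp.1; have iM := integrable_majorant mf bf.
split; first exact: integrable_linear_statistic.
have [|-> _] := moments_of_product_formula rX mf bf iM
  (s := map (wmean f psi) (index_enum 'I_N)).
  by move=> r; rewrite big_map; exact: expectation_prod_onb.
by rewrite /sum1 big_map.
Qed.

(** The mean is a trace, hence independent of the basis. The variance needs this for f^2, whose form
    need not be diagonal in the basis adapted to f. *)
Lemma expectation_linear_statistic_onb h psi : onb lam K psi ->
  measurable_fun setT h -> bounded_fun h ->
  P.-integrable setT (EFin \o linear_statistic X h) /\
  \int[P]_w linear_statistic X h w = \sum_i wmean h psi i.
Proof.
move=> opsi mh bh.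
have [psi' [w [opsi' hdiag w0 [w1 w1'] hw]]] := onb_diagonalize opsi mh bh.
have [-> ->] := expectation_linear_statistic opsi' mh bh hdiag; split=> //.
rewrite [RHS](eq_bigr _ (fun a _ => hw a)) exchange_big/=.
by apply: eq_bigr => i _; rewrite -mulr_suml w1' mul1r.
Qed.

Lemma variance_linear_statistic f psi : onb lam K psi ->
  measurable_fun setT f -> bounded_fun f ->
  (forall i j, i != j -> wgram lam f psi i j = 0) ->
  fine 'E_P[linear_statistic X f]%E = \sum_i wmean f psi i /\
  fine 'V_P[linear_statistic X f]%E = \sum_i wvar f psi i.
Proof.
move=> opsi mf bf fdiag; have rX := dpp.1; have iM := integrable_majorant mf bf.
have [iX EX] := expectation_linear_statistic opsi mf bf fdiag.
have [iX2 EX2] := expectation_linear_statistic_onb opsi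
  (measurable_funX 2 mf) (bounded_fun_sqr bf).
have ie2 := integrable_elem2 rX mf iM.
have [|_ Ee2] := moments_of_product_formula rX mf bf iM
  (s := map (wmean f psi) (index_enum 'I_N)).
  by move=> r; rewrite big_map; exact: expectation_prod_onb.
have EXE : fine 'E_P[linear_statistic X f]%E = \sum_i wmean f psi i.
  by rewrite unlock.
split=> //; pose m := fine 'E_P[linear_statistic X f]%E.
have mE : m = \sum_i wmean f psi i by [].
rewrite /variance unlock -/m [in LHS]unlock.
pose e w := elem2 (map f (X w)).
(* Newton's identity X_f^2 = 2 e_2 + X_(f^2) reduces the variance to expectations that are already
   known. *)
transitivity (\int[P]_w (2 * e w + linear_statistic X (fun x => f x ^+ 2) w
    - 2 * m * linear_statistic X f w + m ^+ 2 * 1)).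
  rewrite /Rintegral; congr fine; apply: eq_integral => w _; congr EFin => /=.
  rewrite /e /elem2 -linear_statistic_sum1 -linear_statistic_sum2.
  rewrite /cst /=.
  by rewrite mulrfctE /=; field.
have i0 : P.-integrable setT (EFin \o (fun=> 1 : R)).
  exact: finite_measure_integrable_cst.
have Rint1 : \int[P]_w (1 : R) = 1.
  by rewrite Rintegral_cst// mul1r; exact: (congr1 fine (probability_setT P)).
have j1 := integrable_scale 2 ie2.
have j2 := integrable_add j1 iX2.
have j3 := integrable_scale (2 * m) iX.
have j4 := integrable_sub j2 j3.
have j5 := integrable_scale (m ^+ 2) i0.
rewrite RintegralD// RintegralB// RintegralD//.
rewrite (RintegralZl 2)// (RintegralZl (2 * m))// (RintegralZl (m ^+ 2))//.
rewrite Rint1 EX EX2 mE Ee2 /elem2 /sum1 /sum2 !big_map /wvar sumrB.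
by field.
Qed.

End Determinantal.

(** * Exponential moments and Chernoff bounds *)

Section Tails.
Context {d d' : measure_display} {T : measurableType d} {R : realType}.
Context {Omega : measurableType d'}.
Variables (P : probability Omega R).

Lemma measurable_superlevel (Y : Omega -> R) (c : R) : measurable_fun setT Y ->
  measurable [set w | c <= Y w].
Proof.
move=> mY; have := mY measurableT _ (measurable_itv `[c, +oo[).
rewrite setTI; congr measurable; apply/seteqP; split=> w /=.
  by rewrite in_itv/= andbT.
by rewrite in_itv/= andbT.
Qed.

Lemma chernoff_bound (Y : Omega -> R) (t a c eps : R) : measurable_fun setT Y ->
  0 < t -> ('E_P[fun w => expR (t * Y w)] <= (expR (t * a + c))%:E)%E ->
  (P [set w | (eps <= Y w - a)%R] <= (expR (c - t * eps))%:E)%E.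
Proof.
move=> mY t0 EY.
pose Z : {RV P >-> R} := mfun_Sub (mem_set mY).
have -> : [set w | eps <= Y w - a] = [set w | a + eps <= Z w].
  by apply/seteqP; split=> w /=; rewrite lerBrDl.
apply: le_trans (chernoff Z (a + eps) t0) _.
have -> : 'M_P Z t = ('E_P[fun w => expR (t * Y w)])%E.
  rewrite /mmt_gen_fun; congr expectation; apply/funext => w /=.
  by rewrite mulrC.
apply: (@le_trans _ _ ((expR (t * a + c))%:E * (expR (- (t * (a + eps))))%:E)%E).
  by rewrite lee_wpmul2r// lee_fin expR_ge0.
by rewrite -EFinM -expRD lee_fin ler_expR mulrDr; lra.
Qed.

Variables (X : Omega -> seq T).
Variables (lam : {measure set T -> \bar R}) (N : nat) (K : T -> T -> R[i]).
Hypothesis dpp : determinantal_process P X lam K N.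
Variables (f : T -> R) (psi : 'I_N -> T -> R[i]) (M : R).
Hypothesis opsi : onb lam K psi.
Hypothesis mf : measurable_fun setT f.
Hypothesis fM : forall x, `|f x| <= M.

Let bf : bounded_fun f.
Proof. by apply/bounded_funP; exists M. Qed.

Local Notation b := (wmean lam f psi).
Local Notation v := (wvar lam f psi).

Lemma wmean_le_bound i : `|b i| <= M.
Proof.
have m1 : measurable_fun setT (fun _ : T => M) by exact: measurable_cst.
have m2 : measurable_fun setT (fun _ : T => - M) by exact: measurable_cst.
rewrite ler_norml -[leLHS](wmean_cst (- M) i opsi) -[X in _ && (_ <= X)](wmean_cst M i opsi).
apply/andP; split; apply: (le_wmean i opsi) => //; try exact: bounded_fun_cst.
- by move=> x; have := fM x; rewrite ler_norml => /andP[].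
- by move=> x; have := fM x; rewrite ler_norml => /andP[].
Qed.

Section Laplace.
Variable t : R.
Hypothesis tM : `|t| * M <= 1 / 3.
Local Notation h := (fun x => expR (t * f x) - 1).

Lemma tilt_bound x : `|t * f x| <= 1 / 3.
Proof. by rewrite normrM (le_trans _ tM)// ler_wpM2l. Qed.

Lemma measurable_tilt : measurable_fun setT h.
Proof.
apply: measurable_funB; last exact: measurable_cst.
by apply: measurableT_comp => //; apply: measurable_funM => //; exact: measurable_cst.
Qed.

Lemma bounded_tilt : bounded_fun h.
Proof.
apply/bounded_funP; exists (expR (1 / 3) + 1) => x.
have := tilt_bound x; rewrite ler_norml => /andP[_ tf].
rewrite (le_trans (ler_normB _ _))// normr1 lerD2r ger0_norm ?expR_ge0//.
by rewrite ler_expR.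
Qed.

(** Bernstein's bound for the single variable f(xi_i): after centring, the linear term of the
    quadratic majorant has mean zero. *)
Lemma wmean_expR_le i : 1 + wmean lam h psi i <= expR (t * b i + 2 * t ^+ 2 * v i).
Proof.
set E := expR (t * b i).
(* Coefficients in powers of f of E (1 + t(f - b) + 2 t^2 (f - b)^2) - 1, the form expected by
   [wmean_quadratic]. *)
pose a0 := E * (1 - t * b i + 2 * t ^+ 2 * b i ^+ 2) - 1.
pose a1 := E * (t - 4 * t ^+ 2 * b i).
pose a2 := E * (2 * t ^+ 2).
have mq : measurable_fun setT (fun x => a0 + a1 * f x + a2 * f x ^+ 2).
  apply: measurable_funD.
    by apply: measurable_funD; [exact: measurable_cst|
      apply: measurable_funM => //; exact: measurable_cst].
  by apply: measurable_funM; [exact: measurable_cst|exact: measurable_funX].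
have bq : bounded_fun (fun x => a0 + a1 * f x + a2 * f x ^+ 2).
  apply/bounded_funP; exists (`|a0| + `|a1| * M + `|a2| * M ^+ 2) => x.
  rewrite (le_trans (ler_normD _ _))// lerD//.
    by rewrite (le_trans (ler_normD _ _))// lerD2l normrM ler_wpM2l.
  rewrite normrM ler_wpM2l// normrX lerXn2r// nnegrE//.
  exact: le_trans (fM x).
have hq x : h x <= a0 + a1 * f x + a2 * f x ^+ 2.
  have -> : a0 + a1 * f x + a2 * f x ^+ 2 =
      E * (1 + t * (f x - b i) + 2 * (t * (f x - b i)) ^+ 2) - 1.
    by rewrite /a0 /a1 /a2; ring.
  rewrite lerD2r [t * f x](_ : _ = t * b i + t * (f x - b i)); last by ring.
  rewrite expRD ler_wpM2l ?expR_ge0// expR_le_quadratic//.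
  rewrite normrM; apply: (@le_trans _ _ (`|t| * (M + M))); last by rewrite mulrDr; move: tM; lra.
  by rewrite ler_wpM2l// (le_trans (ler_normB _ _))// lerD// wmean_le_bound.
have := le_wmean i opsi measurable_tilt bounded_tilt mq bq hq.
rewrite (wmean_quadratic i _ _ _ opsi mf bf) => hle.
rewrite expRD -/E.
apply: (@le_trans _ _ (E * (1 + 2 * t ^+ 2 * v i))).
  by move: hle; rewrite /a0 /a1 /a2 /wvar; lra.
by rewrite ler_wpM2l ?expR_ge0// expR_ge1Dx.
Qed.

(** In the basis adapted to the tilt the Laplace transform is an exact product of eigenvalues;
    [prod_le_prod_average] moves it to an arbitrary orthonormal basis [psi]. The choice of [psi]
    adapted to f is made in [two_sided_tail], where the [v i] must sum to the variance. *)
Lemma mgf_le : ('E_P[fun w => expR (t * linear_statistic X f w)] <=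
    (expR (t * (\sum_i b i) + 2 * t ^+ 2 * \sum_i v i))%:E)%E.
Proof.
have [psi' [w [opsi' hdiag w0 [w1 w1'] hw]]] :=
  onb_diagonalize opsi measurable_tilt bounded_tilt.
have -> : (fun w => expR (t * linear_statistic X f w)) =
    fun w => \prod_(x <- X w) (1 + 1 * h x).
  apply/funext => o; rewrite /linear_statistic; elim: (X o) => [|x s IH].
    by rewrite !big_nil mulr0 expR0.
  by rewrite !big_cons mulrDr expRD IH mul1r addrC subrK.
rewrite (expectation_prod_onb dpp opsi' measurable_tilt bounded_tilt hdiag) lee_fin.
(* The logarithms in Hadamard's inequality need positive eigenvalues; these are at least
   e^(-1/3). *)
have y0 i : 0 < 1 + 1 * wmean lam h psi' i.
  have hc x : expR (- (1 / 3)) - 1 <= h x.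
    by have := tilt_bound x; rewrite ler_norml lerD2r ler_expR => /andP[].
  have mc : measurable_fun setT (fun _ : T => expR (- (1 / 3)) - 1 : R).
    exact: measurable_cst.
  have := le_wmean i opsi' mc (bounded_fun_cst _) measurable_tilt bounded_tilt hc.
  rewrite (wmean_cst _ i opsi') => hle.
  by have := expR_gt0 (- (1 / 3) : R); lra.
apply: (le_trans (prod_le_prod_average w0 w1 w1' y0)).
rewrite !mulr_sumr -big_split/= expR_sum; apply: ler_prod => a _.
have wE : \sum_i w a i * (1 + 1 * wmean lam h psi' i) = 1 + wmean lam h psi a.
  transitivity (\sum_i w a i + \sum_i w a i * wmean lam h psi' i).
    by rewrite -big_split/=; apply: eq_bigr => i _; rewrite mul1r mulrDr mulr1.
  by rewrite w1 -hw.
rewrite [X in _ && (X <= _)]wE wmean_expR_le andbT sumr_ge0// => i _.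
by rewrite mulr_ge0// ltW.
Qed.

End Laplace.

End Tails.

(** * Two-sided tails and the choice of t *)

Section Concentration.
Context {d d' : measure_display} {T : measurableType d} {R : realType}.
Context {Omega : measurableType d'}.
Variables (P : probability Omega R) (X : Omega -> seq T).
Variables (lam : {measure set T -> \bar R}) (N : nat) (K : T -> T -> R[i]).

Lemma two_sided_tail (f : T -> R) (M t eps : R) :
  projection_kernel lam K N -> determinantal_process P X lam K N ->
  measurable_fun setT f -> (forall x, `|f x| <= M) ->
  0 < t -> t * M <= 1 / 3 ->
  (P [set w | (eps <= `|linear_statistic X f w
                        - fine 'E_P[linear_statistic X f]|)%R] <=
    (2 * expR (2 * t ^+ 2 * fine 'V_P[linear_statistic X f] - t * eps))%:E)%E.
Proof.
move=> pk dpp mf fM t0 tM; set Xf := linear_statistic X f.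
have bf : bounded_fun f by apply/bounded_funP; exists M.
have [psi0 opsi0] := projection_kernel_onb pk.
have [psi [_ [opsi fdiag _ _ _]]] := onb_diagonalize opsi0 mf bf.
have [-> ->] := variance_linear_statistic dpp opsi mf bf fdiag.
have mX : measurable_fun setT Xf := measurable_linear_statistic dpp.1 mf.
set m := \sum_i wmean lam f psi i; set V := \sum_i wvar lam f psi i.
have tN : `|t| * M <= 1 / 3 by rewrite gtr0_norm.
have tN' : `|- t| * M <= 1 / 3 by rewrite normrN.
have up := chernoff_bound eps mX t0 (mgf_le dpp opsi mf fM tN).
have mXN : measurable_fun setT (fun w => - Xf w) by exact: measurableT_comp.
(* The lower tail uses the Laplace bound at [- t], whose quadratic term is unchanged. *)
have EN : ('E_P[fun w => expR (t * - Xf w)%R] <=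
    (expR (t * - m + 2 * t ^+ 2 * V))%:E)%E.
  have := mgf_le dpp opsi mf fM tN'.
  rewrite sqrrN mulNr -mulrN => le_; apply: le_trans le_.
  by under eq_fun do rewrite mulrN -mulNr.
have down := chernoff_bound eps mXN t0 EN.
have mU : measurable [set w | eps <= Xf w - m].
  by apply: measurable_superlevel; apply: measurable_funB => //; exact: measurable_cst.
have mD : measurable [set w | eps <= - Xf w - - m].
  by apply: measurable_superlevel; apply: measurable_funB => //; exact: measurable_cst.
have -> : [set w | eps <= `|Xf w - m|] =
    [set w | eps <= Xf w - m] `|` [set w | eps <= - Xf w - - m].
  apply/seteqP; split=> w /=.
    by rewrite ler_normr => /orP[?|]; [left|rewrite opprB => ?; right; lra].
  by rewrite ler_normr => -[->//|h]; apply/orP; right; lra.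
apply: le_trans (measureU2 P mU mD) _.
by rewrite mulrDl mul1r EFinD leeD.
Qed.

End Concentration.

Theorem theorem3p1 (R : realType) :
  exists2 A : R, 0 < A &
  forall (Lambda : ptopologicalType)
    (lam : {measure set (borel Lambda) -> \bar R})
    (K : borel Lambda -> borel Lambda -> R[i]) (N : nat)
    (d : measure_display) (Omega : measurableType d) (P : probability Omega R)
    (X : Omega -> seq (borel Lambda))
    (f : borel Lambda -> R) (eps : R),
    locally_compact [set: Lambda] ->
    polish R Lambda ->
    radon_measure lam ->
    projection_kernel lam K N ->
    determinantal_process P X lam K N ->
    measurable_fun setT f -> bounded_fun f -> (exists x, f x <> 0) ->
    0 < eps ->
    let Xf := linear_statistic X f in
    let VarXf := fine 'V_P[Xf] in
    (P [set w | (eps <= `|Xf w - fine 'E_P[Xf]|)%R] <=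
     (if (eps < 2 * A * VarXf / (3 * sup_norm f))%R
      then (2 * expR (- (eps ^+ 2 / (4 * A * VarXf))))%R
      else (2 * expR (- (eps / (6 * sup_norm f))))%R)%:E)%E.
Proof.
exists 2; first by [].
move=> Lambda lam K N d Omega P X f eps _ _ _ pk dpp mf bf [x0 fx0] eps0.
cbv zeta; set Xf := linear_statistic X f; set V := fine 'V_P[Xf].
have fM x : `|f x| <= sup_norm f.
  have [M hM] := (bounded_funP f).1 bf.
  apply: ub_le_sup; last by exists x.
  by exists M => _ [y _ <-]; exact: hM.
set M := sup_norm f in fM *.
(* Positivity excludes the convention that division by 0 gives 0. *)
have M0 : 0 < M by apply: lt_le_trans (fM x0); rewrite normr_gt0; exact/eqP.
have tail t := two_sided_tail eps pk dpp mf fM (t := t).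
case: ifPn => [small|]; last rewrite -leNgt => large.
- have V0 : 0 < V.
    have : 0 < 2 * 2 * V / (3 * M) := lt_trans eps0 small.
    by rewrite ltr_pdivlMr ?mulr_gt0// mul0r; lra.
  (* The minimiser of 2 t^2 V - t eps, with value -eps^2/(8V), which is the stated exponent for A =
     2. The case hypothesis eps < 4V/(3M) says that t M < 1/3. *)
  have t0 : 0 < eps / (4 * V) by rewrite divr_gt0// mulr_gt0.
  have tM : eps / (4 * V) * M <= 1 / 3.
    move: small; rewrite ltr_pdivlMr ?mulr_gt0// => small.
    by rewrite mulrAC ler_pdivrMr ?mulr_gt0//; lra.
  have := tail _ t0 tM; rewrite -/Xf -/V => /le_trans; apply.
  rewrite lee_fin ler_wpM2l// ler_expR le_eqVlt; apply/orP; left; apply/eqP.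
  by field; rewrite gt_eqF.
- have t0 : 0 < (3 * M)^-1 by rewrite invr_gt0 mulr_gt0.
  have tM : (3 * M)^-1 * M <= 1 / 3.
    by rewrite le_eqVlt; apply/orP; left; apply/eqP; field; rewrite gt_eqF.
  have := tail _ t0 tM; rewrite -/Xf -/V => /le_trans; apply.
  rewrite lee_fin ler_wpM2l// ler_expR.
  have -> : 2 * (3 * M)^-1 ^+ 2 * V - (3 * M)^-1 * eps =
      (2 * 2 * V / (3 * M) - eps) / (6 * M) - eps / (6 * M).
    by field; rewrite gt_eqF.
  by rewrite gerDr mulr_le0_ge0 ?subr_le0// invr_ge0 mulr_ge0// ltW.
Qed.
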